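(* Let $n\ge 1$ and let $\mathcal{A}$ be a coefficient-free cluster algebra of type $A_n$ with cluster pattern $\{(\mathbf{x}_t,B_t)\}_{t\in\mathbb{T}_n}$, where $\mathbf{x}_t=(x_{1;t},\dots,x_{n;t})$, and with initial cluster $\mathbf{x}=\mathbf{x}_{t_0}=(x_1,\dots,x_n)$ at an arbitrary vertex $t_0\in\mathbb{T}_n$. Then every cluster variable $x_{i;t}$ ($1\le i\le n$, $t\in\mathbb{T}_n$), expressed as a Laurent polynomial in $x_1,\dots,x_n$, is log-concave. That is, the coefficient-free cluster algebras of type $A_n$ are log-concave.
   Context: **Log-concavity of Laurent polynomials.** A nonzero Laurent polynomial with non-negative real coefficients $f(x_1,\dots,x_m)=\sum_{i_1=l_1}^{n_1}\cdots\sum_{i_m=l_m}^{n_m}a_{i_1,\dots,i_m}x_1^{i_1}\cdots x_m^{i_m}$ is called log-concave if for every $1\le j\le m$ and all indices with $l_j\le i_j\le n_j$ one has $$a_{i_1,\dots,i_j,\dots,i_m}^2\ \ge\ a_{i_1,\dots,i_j-1,\dots,i_m}\,a_{i_1,\dots,i_j+1,\dots,i_m},$$ where coefficients with $j$-th index equal to $l_j-1$ or $n_j+1$ are set to $0$. (That is, log-concavity is required along each coordinate direction separately.) **Coefficient-free cluster algebras.** Write $[a]_+=\max(a,0)$. A (labeled) seed of rank $n$ is a pair $(\mathbf{x},B)$, where $\mathbf{x}=(x_1,\dots,x_n)$ is a tuple of algebraically independent generators of a field $\mathcal{F}$ of rational functions in $n$ variables over $\mathbb{Q}$, and $B=(b_{ij})\in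 \mathrm{Mat}_{n\times n}(\mathbb{Z})$ is skew-symmetrizable. The mutation $\mu_k(\mathbf{x},B)=(\mathbf{x}',B')$, $1\le k\le n$, is given by $x_i'=x_i$ for $i\ne k$, $x_k'=x_k^{-1}\big(\prod_{j}x_j^{[b_{jk}]_+}+\prod_{j}x_j^{[-b_{jk}]_+}\big)$, and $b_{ij}'=-b_{ij}$ if $i=k$ or $j=k$, $b_{ij}'=b_{ij}+[b_{ik}]_+b_{kj}+b_{ik}[-b_{kj}]_+$ otherwise. Let $\mathbb{T}_n$ be the $n$-regular tree whose edges are labeled by $1,\dots,n$ so that the $n$ edges at each vertex have distinct labels. A cluster pattern assigns to each vertex $t\in\mathbb{T}_n$ a seed $(\mathbf{x}_t,B_t)$ such that seeds joined by an edge labeled $k$ are related by $\mu_k$. The elements $x_{i;t}$ are the cluster variables, and the cluster algebra $\mathcal{A}$ is the $\mathbb{Z}$-subalgebra of $\mathcal{F}$ generated by all of them. It is known that each $x_{i;t}$ is a Laurent polynomial in the initial cluster with non-negative integer coefficients. **Type $A_n$.** The Cartan counterpart of $B$ is the matrix $A(B)=(a_{ij})$ with $a_{ii}=2$ and $a_{ij}=-|b_{ij}|$ for $i\neq j$. The cluster algebra is of type $A_n$ if some exchange matrix $B_t$ in the pattern has Cartan counterpart equal (up to simultaneous permutation of rows and columns) to the Cartan matrix of type $A_n$. The initial exchange matrix $B_{t_0}$ need not itself be the one with this property. **Log-concavity of cluster algebras.** A cluster variable $x_{i;t}$ of a coefficient-free cluster algebra is called log-concave if it is log-concave as a Laurent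 polynomial in the initial cluster. The cluster algebra is called log-concave if all its cluster variables are log-concave. *)

(* Defs.v *)
From HB Require Import structures.
From mathcomp Require Import all_boot all_order all_algebra fraction.
From mathcomp Require Import perm finmap mpoly.

Set Implicit Arguments.
Unset Strict Implicit.
Unset Printing Implicit Defensive.

Import Order.TTheory GRing.Theory Num.Theory.

Local Open Scope ring_scope.

(* A Laurent polynomial is its finitely supported coefficient family: f e is  *)
(* the coefficient of x_1^(e_1) ... x_m^(e_m).                                *)
Definition laurent (R : realDomainType) (m : nat) :=
  {fsfun {ffun 'I_m -> int} -> R with 0}.

Definition unit_exp (m : nat) (j : 'I_m) : {ffun 'I_m -> int} :=
  [ffun i => (i == j)%:Z].

(* Coefficients outside the support are 0, so e ranges over all exponents:    *)
(* beyond a box containing the support the inequality reads 0 >= 0.           *)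
Definition log_concave (R : realDomainType) (m : nat) (f : laurent R m) : Prop :=
  [/\ exists e : {ffun 'I_m -> int}, f e != 0,
      forall e : {ffun 'I_m -> int}, 0 <= f e
    & forall (j : 'I_m) (e : {ffun 'I_m -> int}),
        f (e - unit_exp j) * f (e + unit_exp j) <= f e ^+ 2].

Definition ambient (n : nat) : fieldType := {fraction {mpoly rat[n]}}.

Definition ratconst (n : nat) (c : rat) : ambient n := @tofrac {mpoly rat[n]} c%:MP.

Definition peval (n : nat) (x : {ffun 'I_n -> ambient n}) (p : {mpoly rat[n]}) :
    ambient n :=
  mmap (@ratconst n) x p.

Definition laurent_eval (n : nat) (x : {ffun 'I_n -> ambient n})
    (f : laurent rat n) : ambient n :=
  \sum_(e <- finsupp f) ratconst n (f e) * \prod_(i < n) x i ^ e i.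

Definition free_generators (n : nat) (x : {ffun 'I_n -> ambient n}) : Prop :=
  (forall p : {mpoly rat[n]}, peval x p = 0 -> p = 0) /\
  (forall z : ambient n, exists p q : {mpoly rat[n]},
     peval x q != 0 /\ z = peval x p / peval x q).

Definition skew_symmetrizable (n : nat) (B : 'M[int]_n) : Prop :=
  exists d : 'rV[int]_n,
    (forall i, 0 < d 0 i) /\ (diag_mx d *m B)^T = - (diag_mx d *m B).

Record preseed (n : nat) := Preseed {
  cluster : {ffun 'I_n -> ambient n};
  exchange_mx : 'M[int]_n
}.

Definition is_seed (n : nat) (s : preseed n) : Prop :=
  free_generators (cluster s) /\ skew_symmetrizable (exchange_mx s).

Definition pos_part (a : int) : int := Num.max a 0.

Definition mutate_cluster (n : nat) (k : 'I_n) (s : preseed n) :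
    {ffun 'I_n -> ambient n} :=
  let x := cluster s in let B := exchange_mx s in
  [ffun i => if i == k then
     (x k)^-1 * (\prod_(j < n) x j ^ pos_part (B j k)
                 + \prod_(j < n) x j ^ pos_part (- B j k))
   else x i].

Definition mutate_mx (n : nat) (k : 'I_n) (B : 'M[int]_n) : 'M[int]_n :=
  \matrix_(i, j) if (i == k) || (j == k) then - B i j
    else B i j + pos_part (B i k) * B k j + B i k * pos_part (- B k j).

Definition mutate (n : nat) (k : 'I_n) (s : preseed n) : preseed n :=
  Preseed (mutate_cluster k s) (mutate_mx k (exchange_mx s)).

(* The n-regular tree with edges labelled by 'I_n: its vertices are the words *)
(* without two equal consecutive letters, and an edge labelled k joins w and  *)
(* k :: w whenever both are such words.                                       *)
Definition regular_tree (n : nat) :=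
  {w : seq 'I_n | sorted (fun i j => i != j) w}.

Definition tree_edge (n : nat) (k : 'I_n) (t t' : regular_tree n) : bool :=
  (val t' == k :: val t) || (val t == k :: val t').

Definition cluster_pattern (n : nat) (S : regular_tree n -> preseed n) : Prop :=
  (forall t, is_seed (S t)) /\
  (forall (k : 'I_n) (t t' : regular_tree n),
     tree_edge k t t' -> S t' = mutate k (S t)).

Definition cartan_counterpart (n : nat) (B : 'M[int]_n) : 'M[int]_n :=
  \matrix_(i, j) if i == j then 2 else - `|B i j|.

Definition cartan_A (n : nat) : 'M[int]_n :=
  \matrix_(i, j) if i == j then 2
    else if (i.+1 == j :> nat) || (j.+1 == i :> nat) then -1 else 0.

Definition type_A (n : nat) (S : regular_tree n -> preseed n) : Prop :=
  exists (t : regular_tree n) (s : {perm 'I_n}),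
    row_perm s (col_perm s (cartan_counterpart (exchange_mx (S t)))) = cartan_A n.

(* The Laurent expansion in a cluster is unique, by algebraic independence.   *)
Definition log_concave_in (n : nat) (x : {ffun 'I_n -> ambient n})
    (z : ambient n) : Prop :=
  exists f : laurent rat n, laurent_eval x f = z /\ log_concave f.

Definition log_concave_cluster_algebra (n : nat)
    (S : regular_tree n -> preseed n) (t0 : regular_tree n) : Prop :=
  forall (i : 'I_n) (t : regular_tree n),
    log_concave_in (cluster (S t0)) (cluster (S t) i).

(* Main.v *)
(** A seed of type A is a triangulation of a polygon whose vertices are vectors
    of the plane over the ambient field: the cluster variables are the minors
    [x_ab] of the diagonals [ab], the sides have minor 1, and mutation is the flip
    of a diagonal, because of the Pluecker relation.  So every cluster variable is
    a minor [x_ab], to be expanded in the diagonals of the initial triangulation.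

    Cut the segment [ab] at a diagonal [t = pr] that it crosses: then
    [x_ab = (x_ap x_br + x_ar x_bp) / t], where the factors involve disjoint sets
    of variables apart from [t].  A diagonal that is not crossed occurs with
    exponents 0 and 1 only, and a crossed diagonal [j] with exponents -1, 0, 1,
    all three of them only if the two triangles at [j] form a zigzag.  In that case,
    with [P, R] and [P', R'] the pairs of minors at the preceding diagonals
    [t, t'] and [s, s'] the third sides of the two triangles, the coefficients of
    [j^-1, j^0, j^1] are
      [P P' (1 + s s' / (t t'))],  [(P R' s + R P' s') / (t t')],  [R R' / (t t')].
    As [P] and [R / t] have no common monomial, only [P P' s s' / (t t')] can meet
    [R R' / (t t')], and only if [s = s' = 1]; then the inequality is
    [u w <= (u + w)^2] for the coefficients [u] of [P R'] and [w] of [R P']. *)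

Require Import Defs.
From mathcomp Require Import all_boot all_order all_algebra.
From mathcomp Require Import fraction perm finmap mpoly zify ring.

Set Implicit Arguments.
Unset Strict Implicit.
Unset Printing Implicit Defensive.

Import Order.TTheory GRing.Theory Num.Theory.

Local Open Scope ring_scope.

(** * Laurent polynomials as multisets of exponents *)

Definition label_exp (n : nat) (l : option 'I_n) : {ffun 'I_n -> int} :=
  if l is Some j then unit_exp j else 0.

Lemma label_expE (n : nat) (l : option 'I_n) (i : 'I_n) :
  label_exp l i = (l == Some i)%:Z.
Proof.
case: l => [j|] /=; last by rewrite ffunE.
by rewrite ffunE eq_sym.
Qed.

(** A Laurent polynomial with natural coefficients is a sequence of exponents with repetitions, the
    coefficient of [e] being its multiplicity; [shift] is then multiplication by a monomial and
    [tens] the product. *)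
Definition shift (V : zmodType) (c : V) (s : seq V) := [seq c + e | e <- s].

Definition tens (V : zmodType) (s s' : seq V) := [seq e + e' | e <- s, e' <- s'].

Lemma shift_cat (V : zmodType) (c : V) (s s' : seq V) :
  shift c (s ++ s') = shift c s ++ shift c s'.
Proof. exact: map_cat. Qed.

Lemma count_shift (V : zmodType) (c e : V) (s : seq V) :
  count_mem e (shift c s) = count_mem (e - c) s.
Proof.
rewrite count_map; apply: eq_count => a /=.
by rewrite [RHS]eq_sym subr_eq eq_sym [c + a]addrC.
Qed.

Lemma count_tens_cons (V : zmodType) (e a : V) (s s' : seq V) :
  count_mem e (tens (a :: s) s') =
  (count_mem (e - a)%R s' + count_mem e (tens s s'))%N.
Proof. by rewrite /tens allpairs_cons count_cat -/(shift a s') count_shift. Qed.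

Lemma count_tens_catl (V : zmodType) (e : V) (s1 s2 s : seq V) :
  count_mem e (tens (s1 ++ s2) s) =
  (count_mem e (tens s1 s) + count_mem e (tens s2 s))%N.
Proof. by rewrite /tens allpairs_cat count_cat. Qed.

Lemma count_tensC (V : zmodType) (e : V) (s s' : seq V) :
  count_mem e (tens s s') = count_mem e (tens s' s).
Proof.
elim: s => [|a s IH]; last first.
  rewrite count_tens_cons IH; elim: s' {IH} => [//|b s' IH].
  rewrite !count_tens_cons -{}IH /=.
  rewrite (_ : (b == e - a) = (a == e - b)); first exact: addnACA.
  by apply/eqP/eqP => ->; rewrite subKr.
by rewrite /tens; elim: s'.
Qed.

Lemma tens_shiftl (V : zmodType) (c : V) (s s' : seq V) :
  tens (shift c s) s' = shift c (tens s s').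
Proof.
rewrite /tens; elim: s => [//|a s IH]; rewrite [shift c (a :: s)]/=.
rewrite !allpairs_cons IH shift_cat; congr (_ ++ _).
by rewrite /shift -map_comp; apply: eq_map => b /=; rewrite addrA.
Qed.

Lemma eq_count_perm (T : eqType) (s s' : seq T) :
  (forall e, count_mem e s = count_mem e s') -> perm_eq s s'.
Proof. by move=> H; apply/allP => e _ /=; rewrite H. Qed.

Definition restrict (n : nat) (A : pred 'I_n) (e : {ffun 'I_n -> int}) :
    {ffun 'I_n -> int} :=
  [ffun i => if A i then e i else 0].

(** When the factors use disjoint sets of variables, an exponent splits in only one way into a part
    on [A] and a part off [A], so the coefficients multiply. *)
Lemma count_tens_disjoint (n : nat) (A : pred 'I_n)
    (s s' : seq {ffun 'I_n -> int}) (e : {ffun 'I_n -> int}) :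
  (forall (a : {ffun 'I_n -> int}) i, a \in s -> ~~ A i -> a i = 0) ->
  (forall (a : {ffun 'I_n -> int}) i, a \in s' -> A i -> a i = 0) ->
  count_mem e (tens s s') =
  (count_mem (restrict A e) s * count_mem (restrict (predC A) e) s')%N.
Proof.
move=> Hs Hs'; elim: s Hs => [//|a s IH] Hs.
rewrite count_tens_cons IH; last by move=> b i bs; apply: Hs; rewrite in_cons bs orbT.
rewrite /= mulnDl; congr (_ + _)%N.
have Ha i : ~~ A i -> a i = 0 by apply: Hs; exact: mem_head.
have [ae|ae] := eqVneq a (restrict A e).
  rewrite mul1n; congr (count_mem _ _); apply/ffunP => i.
  rewrite ae !ffunE /=; case: ifP => _ /=; ring.
rewrite mul0n; apply/count_memPn/negP => es'.
case/eqP: ae; apply/ffunP => i; rewrite ffunE; case: ifPn => [Ai|/Ha //].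
by have := Hs' _ _ es' Ai; rewrite !ffunE; move=> /eqP; rewrite subr_eq add0r => /eqP.
Qed.

Definition log_concave_along (n : nat) (j : 'I_n) (s : seq {ffun 'I_n -> int}) :=
  forall e, (count_mem (e - unit_exp j)%R s * count_mem (e + unit_exp j)%R s
             <= count_mem e s ^ 2)%N.

Lemma log_concave_along_perm (n : nat) (j : 'I_n) (s s' : seq {ffun 'I_n -> int}) :
  perm_eq s s' -> log_concave_along j s -> log_concave_along j s'.
Proof. by move=> /seq.permP H Hs e; rewrite -!H. Qed.

(** The exponents of [j] take at most two consecutive values, so two exponents at distance 2 cannot
    both occur and the left side vanishes. *)
Lemma log_concave_along_narrow (n : nat) (j : 'I_n) (c : int)
    (s : seq {ffun 'I_n -> int}) :
  (forall e, e \in s -> c <= e j <= c + 1) -> log_concave_along j s.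
Proof.
move=> H e.
case: (boolP (e - unit_exp j \in s)) => [/H|/count_memPn-> //].
case: (boolP (e + unit_exp j \in s)) => [/H|/count_memPn->]; last by rewrite muln0.
by rewrite !ffunE eqxx; lia.
Qed.

(** * Walks through a triangulation *)

(* A walk starts at a vertex a and ends on a diagonal pr, its last arc, with the *)
(* label None for polygon sides. Base u w t is the triangle with sides u = ap,   *)
(* w = ar and t = pr. Step d h s t crosses the last arc of h into the triangle   *)
(* with other sides s and t; t keeps the end p if d = true, the end r otherwise. *)
Inductive walk (n : nat) :=
| Base (u w : option 'I_n) (t : 'I_n)
| Step (d : bool) (h : walk n) (s : option 'I_n) (t : 'I_n).

Definition last_arc (n : nat) (h : walk n) :=
  match h with Base _ _ t => t | Step _ _ _ t => t end.

Fixpoint crossed (n : nat) (h : walk n) : seq 'I_n :=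
  if h is Step _ h' _ _ then last_arc h' :: crossed h' else [::].

Fixpoint labels (n : nat) (h : walk n) : seq (option 'I_n) :=
  match h with
  | Base u w _ => [:: u; w]
  | Step _ h' s _ => [:: s, Some (last_arc h') & labels h']
  end.

(* The exponents of the monomials of x_ap if b = true, of x_ar otherwise. *)
Fixpoint side (n : nat) (h : walk n) (b : bool) : seq {ffun 'I_n -> int} :=
  match h with
  | Base u w _ => [:: label_exp (if b then u else w)]
  | Step d h' s t =>
      if b == d then side h' d
      else shift (label_exp s - unit_exp (last_arc h')) (side h' d)
           ++ shift (unit_exp t - unit_exp (last_arc h')) (side h' (~~ d))
  end.

(* The expansion of x_ab when h goes from a to pr and h' from b to the same arc  *)
(* read as rp, so that the sides x_ap and x_br are paired.                       *)
Definition glue (n : nat) (h h' : walk n) : seq {ffun 'I_n -> int} :=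
  shift (- unit_exp (last_arc h)) (tens (side h true) (side h' true)
                              ++ tens (side h false) (side h' false)).

(** Polygon sides all share the label [None], so only the labels of diagonals have to differ. *)
Definition distinct (T : eqType) (s : seq (option T)) := uniq (pmap id s).

Lemma mem_pmap_id (T : eqType) (s : seq (option T)) (i : T) :
  (i \in pmap id s) = (Some i \in s).
Proof. by rewrite mem_pmap map_id. Qed.

Lemma distinct_cons (T : eqType) (l : option T) (s : seq (option T)) :
  distinct (l :: s) = ((l == None) || (l \notin s)) && distinct s.
Proof. by case: l => [i|] //=; rewrite /distinct /= mem_pmap_id. Qed.

Lemma perm_distinct (T : eqType) (s s' : seq (option T)) :
  perm_eq s s' -> distinct s = distinct s'.
Proof. by move=> H; apply: perm_uniq; rewrite perm_pmap. Qed.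

Lemma distinct_catl (T : eqType) (s s' : seq (option T)) :
  distinct (s ++ s') -> distinct s.
Proof. by rewrite /distinct pmap_cat cat_uniq => /andP[]. Qed.

Lemma distinct_catr (T : eqType) (s s' : seq (option T)) :
  distinct (s ++ s') -> distinct s'.
Proof. by rewrite /distinct pmap_cat cat_uniq => /and3P[]. Qed.

Lemma distinct_cat_notin (T : eqType) (s s' : seq (option T)) (i : T) :
  distinct (s ++ s') -> Some i \in s -> Some i \notin s'.
Proof.
rewrite /distinct pmap_cat cat_uniq => /and3P[_ /hasPn H _] si.
by rewrite -mem_pmap_id; apply/negP => /H; rewrite mem_pmap_id si.
Qed.

Lemma sideP (n : nat) (h : walk n) (d : bool) (s : option 'I_n) (t : 'I_n)
    (b : bool) (e : {ffun 'I_n -> int}) :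
  e \in side (Step d h s t) b ->
  [\/ b = d /\ e \in side h d,
      b = ~~ d /\ (exists2 a, a \in side h d
                    & e = label_exp s - unit_exp (last_arc h) + a)
    | b = ~~ d /\ (exists2 a, a \in side h (~~ d)
                    & e = unit_exp t - unit_exp (last_arc h) + a)].
Proof.
rewrite /=; case: eqVneq => [->|bd]; first by constructor 1.
have {bd}-> : b = ~~ d by case: b d bd => [] [].
by rewrite mem_cat => /orP[] /mapP[a ha ->]; [constructor 2|constructor 3];
  split=> //; exists a.
Qed.

Lemma side_support (n : nat) (h : walk n) (b : bool) (i : 'I_n)
    (e : {ffun 'I_n -> int}) :
  i != last_arc h -> Some i \notin labels h -> e \in side h b -> e i = 0.
Proof.
elim: h b e => [u w t|d h IH s t] b e /= it.
  rewrite !inE negb_or => /andP[iu iw] /eqP->; rewrite label_expE.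
  by case: b; rewrite eq_sym ?(negPf iu) ?(negPf iw).
rewrite !inE !negb_or => /and3P[si iarc ih] he.
have ia : i != last_arc h by apply: contraNneq iarc => ->.
have := sideP he => -[[_ ha]|[_ [a ha ->]]|[_ [a ha ->]]]; first exact: IH ha.
  by rewrite !ffunE label_expE (IH _ _ ia ih ha) eq_sym (negPf si) (negPf ia).
by rewrite !ffunE (IH _ _ ia ih ha) (negPf it) (negPf ia).
Qed.

Lemma distinct_step (n : nat) (d : bool) (h : walk n) (s : option 'I_n) (t : 'I_n) :
  distinct (Some t :: labels (Step d h s t)) ->
  [/\ distinct (Some (last_arc h) :: labels h),
      t != last_arc h /\ Some t \notin labels h, s != Some t, s != Some (last_arc h)
    & forall i, s = Some i -> Some i \notin labels h].
Proof.
rewrite distinct_cons !inE /= !negb_or => /andP[/and3P[ts ta tl]].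
rewrite distinct_cons inE negb_or => /andP[sD hD].
split=> //; first by rewrite eq_sym.
  by case: s sD {ts} => [i|] //= /andP[].
by move=> i si; case/orP: sD => [|/andP[_]]; rewrite si.
Qed.

(** Only crossed arcs are divided by. Any other diagonal enters at most once as a factor, labels
    being distinct, and has exponent 0 in the sides found before ([side_support]). *)
Lemma side_range (n : nat) (h : walk n) (b : bool) (i : 'I_n)
    (e : {ffun 'I_n -> int}) :
  distinct (Some (last_arc h) :: labels h) -> i \notin crossed h ->
  e \in side h b -> 0 <= e i <= 1.
Proof.
elim: h b e => [u w t|d h IH s t] b e.
  by move=> _ _; rewrite inE => /eqP->; rewrite label_expE; case: (_ == _).
move/distinct_step => [hD [ta tl] st sa sl]; rewrite /= inE negb_or => /andP[ia ih].
have supp := side_support ia.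
move=> /sideP[[_ he]|[_ [a ha ->]]|[_ [a ha ->]]]; first exact: IH he.
  have /andP[] := IH _ _ hD ih ha.
  rewrite !ffunE label_expE (negPf ia); case: eqVneq => /= [/sl il|_]; last by lia.
  by rewrite (supp _ _ il ha).
have /andP[] := IH _ _ hD ih ha.
rewrite !ffunE (negPf ia); case: eqVneq => /= [it|_]; last by lia.
by rewrite (supp _ _ _ ha) ?it.
Qed.

Lemma crossed_labels (n : nat) (h : walk n) (i : 'I_n) :
  i \in crossed h -> Some i \in labels h.
Proof.
elim: h => [//|d h IH s t]; rewrite /= !inE => /orP[/eqP->|/IH->].
  by rewrite eqxx orbT.
by rewrite !orbT.
Qed.

Lemma arc_notin_crossed (n : nat) (h : walk n) :
  distinct (Some (last_arc h) :: labels h) -> last_arc h \notin crossed h.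
Proof. by rewrite distinct_cons => /andP[/= H _]; apply: contra H => /crossed_labels. Qed.

(* By induction, [P] and [R / t] have no common monomial. *)
Lemma side_no_common (n : nat) (h : walk n) (b : bool) (e : {ffun 'I_n -> int}) :
  distinct (Some (last_arc h) :: labels h) -> e \in side h b ->
  e + unit_exp (last_arc h) \notin side h (~~ b).
Proof.
elim: h b e => [u w t|d h IH s t] b e.
  rewrite distinct_cons !inE /= negb_or => /andP[/andP[ut wt] _] /eqP->.
  apply/eqP => /ffunP /(_ t); rewrite !ffunE !label_expE eqxx.
  by case: b; rewrite /= ![_ == Some t]eq_sym (negPf ut) (negPf wt).
move/distinct_step => [hD [ta tl] st sa sl]; rewrite [last_arc _]/=.
have supp := side_support ta tl.
move=> /sideP[[-> he]|[-> [a ha ->]]|[-> [a ha ->]]]; apply/negP => /sideP[].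
- by case; case: (d).
- case=> _ [c hc /ffunP /(_ t)].
  rewrite !ffunE label_expE eqxx (negPf ta) (negPf st) /=.
  by rewrite (supp _ _ he) (supp _ _ hc).
- case=> _ [c hc E]; have /negP := IH _ _ hD he; apply.
  by rewrite (_ : e + _ = c) //; apply/ffunP => i; move/ffunP/(_ i): E; rewrite !ffunE; lia.
- case=> _ /supp; rewrite !ffunE label_expE eqxx (negPf ta) (negPf st) (supp _ _ ha) //.
- by case; case: (d).
- by case; case: (d).
- case=> _ /supp; rewrite !ffunE eqxx (negPf ta) (supp _ _ ha) //.
- by case; case: (d).
- by case; case: (d).
Qed.

(** * Gluing two walks *)

Lemma glueE (n : nat) (d : bool) (h h' : walk n) (e : {ffun 'I_n -> int}) :
  count_mem e (glue h h') =
  (count_mem (e + unit_exp (last_arc h))%R (tens (side h d) (side h' d)) +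
   count_mem (e + unit_exp (last_arc h))%R (tens (side h (~~ d)) (side h' (~~ d))))%N.
Proof.
rewrite /glue count_shift opprK count_cat.
by case: d; rewrite // addnC.
Qed.

Lemma glueC (n : nat) (h h' : walk n) :
  last_arc h = last_arc h' -> perm_eq (glue h h') (glue h' h).
Proof.
move=> hh'; apply: eq_count_perm => e.
by rewrite !(glueE true) hh' ![count_mem _ (tens (side h _) _)]count_tensC.
Qed.

Lemma count_side_tens (n : nat) (d : bool) (h : walk n) (s : option 'I_n) (t : 'I_n)
    (f : seq {ffun 'I_n -> int}) (e : {ffun 'I_n -> int}) :
  count_mem e (tens (side (Step d h s t) (~~ d)) f) =
  (count_mem (e - label_exp s + unit_exp (last_arc h))%R (tens (side h d) f) +
   count_mem (e - unit_exp t + unit_exp (last_arc h))%R (tens (side h (~~ d)) f))%N.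
Proof.
rewrite /= (_ : (~~ d == d) = false); last by case: d.
by rewrite count_tens_catl !tens_shiftl !count_shift !opprB !addrA ![e + _ - _]addrAC.
Qed.

Lemma count_tens_side (n : nat) (d : bool) (h : walk n) (s : option 'I_n) (t : 'I_n)
    (f : seq {ffun 'I_n -> int}) (e : {ffun 'I_n -> int}) :
  count_mem e (tens f (side (Step d h s t) (~~ d))) =
  (count_mem (e - label_exp s + unit_exp (last_arc h))%R (tens f (side h d)) +
   count_mem (e - unit_exp t + unit_exp (last_arc h))%R (tens f (side h (~~ d))))%N.
Proof. by rewrite count_tensC count_side_tens !(count_tensC _ f). Qed.

Lemma side_step_same (n : nat) (d : bool) (h : walk n) (s : option 'I_n) (t : 'I_n) :
  side (Step d h s t) d = side h d.
Proof. by rewrite /= eqxx. Qed.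

(** With [P], [R] the sides [d], [~~ d] of [h], with [P'], [R'] those of [h'], and with [u], [t]
    their last arcs, both expansions are P P' / t + s P R' / (u t) + R R' / u. The flag is negated
    because the walk from the other end reads the arcs backwards. *)
Lemma glue_move (n : nat) (d : bool) (h h' : walk n) (s : option 'I_n) :
  perm_eq (glue (Step d h s (last_arc h')) h') (glue h (Step (~~ d) h' s (last_arc h))).
Proof.
apply: eq_count_perm => e; rewrite !(glueE d) [last_arc _]/=.
rewrite side_step_same count_side_tens.
have := @count_tens_side n (~~ d) h' s (last_arc h); rewrite negbK => ->.
rewrite side_step_same.
have E x y z : count_mem (e + x - y + z)%R = count_mem (e + (x + z - y))%R.
  by congr (count_mem _); rewrite -!addrA; do 2 congr (_ + _); exact: addrC.
have K (x y : {ffun 'I_n -> int}) : x + y - x = y by rewrite addrAC subrr add0r.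
rewrite !E !K [unit_exp (last_arc h') + _]addrC addnA; congr (_ + _)%N.
exact: addnC.
Qed.

(** * Log-concavity of glued expansions *)

Lemma tens_range (n : nat) (j : 'I_n) (lo hi lo' hi' : int)
    (s s' : seq {ffun 'I_n -> int}) (e : {ffun 'I_n -> int}) :
  (forall a : {ffun 'I_n -> int}, a \in s -> lo <= a j <= hi) ->
  (forall a : {ffun 'I_n -> int}, a \in s' -> lo' <= a j <= hi') ->
  e \in tens s s' -> lo + lo' <= e j <= hi + hi'.
Proof.
move=> Hs Hs' /allpairsP[[a b] /= [/Hs/andP[l1 h1] /Hs'/andP[l2 h2] ->]].
by rewrite ffunE !lerD.
Qed.

Lemma glue_range (n : nat) (d : bool) (j : 'I_n) (lo hi : int) (h h' : walk n)
    (e : {ffun 'I_n -> int}) :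
  (forall a : {ffun 'I_n -> int}, a \in tens (side h d) (side h' d) -> lo <= a j <= hi) ->
  (forall a : {ffun 'I_n -> int}, a \in tens (side h (~~ d)) (side h' (~~ d)) -> lo <= a j <= hi) ->
  e \in glue h h' ->
  lo - (j == last_arc h)%:Z <= e j <= hi - (j == last_arc h)%:Z.
Proof.
move=> Hd Hd'; rewrite -has_pred1 has_count (glueE d) addn_gt0 -!has_count !has_pred1.
rewrite lerBlDr lerBrDr.
by case/orP => [/Hd|/Hd']; rewrite !ffunE.
Qed.

(** The walks reach the same diagonal from its two sides and share no other one; this separates the
    variables of the two factors. *)
Definition glueable (n : nat) (h h' : walk n) :=
  (last_arc h = last_arc h') /\ distinct (Some (last_arc h) :: labels h ++ labels h').

Lemma glueableC (n : nat) (h h' : walk n) : glueable h h' -> glueable h' h.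
Proof.
move=> [hh' D]; split=> //; rewrite -hh'.
rewrite (@perm_distinct _ _ (Some (last_arc h) :: labels h ++ labels h')) //.
by rewrite perm_cons perm_catC.
Qed.

Lemma glueable_l (n : nat) (h h' : walk n) :
  glueable h h' -> distinct (Some (last_arc h) :: labels h).
Proof. by move=> [_]; rewrite -cat_cons => /distinct_catl. Qed.

Lemma glueable_move (n : nat) (d : bool) (h h' : walk n) (s : option 'I_n) :
  glueable (Step d h s (last_arc h')) h' -> glueable h (Step (~~ d) h' s (last_arc h)).
Proof.
move=> [_ D]; split=> //; move: D; rewrite (@perm_distinct _ _ 
  (Some (last_arc h) :: labels h ++ labels (Step (~~ d) h' s (last_arc h)))) //.
apply: eq_count_perm => e; rewrite /= !count_cat /=; lia.
Qed.

(** As labels are distinct, [j] belongs to at most one of the walks, where it has exponent 0 or 1 by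
    [side_range]. *)
Lemma log_concave_glue_narrow (n : nat) (j : 'I_n) (h h' : walk n) :
  glueable h h' -> j != last_arc h -> j \notin crossed h -> j \notin crossed h' ->
  log_concave_along j (glue h h').
Proof.
move=> G jh jc jc'; have := glueable_l G; have := glueable_l (glueableC G).
case: G => hh' D Dh' Dh.
apply: (@log_concave_along_narrow _ _ 0) => e.
have [jl|jl] := boolP (Some j \in labels h).
  have jl' : Some j \notin labels h'.
    by apply: distinct_cat_notin jl; move: D; rewrite distinct_cons => /andP[].
  move/(@glue_range _ true j 0 1); rewrite (negPf jh) subr0 add0r; apply => a;
    apply: (@tens_range _ j 0 1 0 0) => b hb.
  - exact: side_range hb.
  - by rewrite (side_support _ jl' hb) // -hh'.
  - exact: side_range hb.
  - by rewrite (side_support _ jl' hb) // -hh'.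
move/(@glue_range _ true j 0 1); rewrite (negPf jh) subr0 add0r; apply => a;
  apply: (@tens_range _ j 0 0 0 1) => b hb.
- by rewrite (side_support _ jl hb).
- exact: side_range hb.
- by rewrite (side_support _ jl hb).
- exact: side_range hb.
Qed.

Lemma side_step_arc (n : nat) (d : bool) (h : walk n) (s : option 'I_n) (j : 'I_n)
    (b : bool) (e : {ffun 'I_n -> int}) :
  distinct (Some j :: labels (Step d h s j)) ->
  e \in side (Step d h s j) b -> 0 <= e j <= (b != d)%:Z.
Proof.
move=> D he; have [bd|bd] := eqVneq b d; last first.
  exact: (@side_range _ (Step d h s j) b j e D (@arc_notin_crossed _ (Step d h s j) D) he).
have [_ [jh jl] _ _ _] := distinct_step D.
by move: he; rewrite bd side_step_same => /(side_support jh jl)->.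
Qed.

(** Equal flags mean that the two triangles at [j] keep opposite ends of [j], since the second walk
    reads it backwards: this is the zigzag. *)
Lemma log_concave_glue_zigzag (n : nat) (d : bool) (j : 'I_n) (h h' : walk n)
    (s s' : option 'I_n) :
  glueable (Step d h s j) (Step d h' s' j) ->
  log_concave_along j (glue (Step d h s j) (Step d h' s' j)).
Proof.
move=> G e; have := glueable_l G; have := glueable_l (glueableC G).
case: G => _ D D' D0.
have [Dh [jh jl] sj sh sl] := distinct_step D0.
have [Dh' [jh' jl'] sj' sh' sl'] := distinct_step D'.
have Hj b : forall a, a \in side h b -> a j = 0 by move=> a; exact: side_support.
have Hj' b : forall a, a \in side h' b -> a j = 0 by move=> a; exact: side_support.
have Z b b' (a : {ffun 'I_n -> int}) : a j != 0 ->
    count_mem a (tens (side h b) (side h' b')) = 0%N.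
  move=> aj; apply/count_memPn; apply: contra aj => /allpairsP[[x y] /= [/Hj hx /Hj' hy ->]].
  by rewrite ffunE hx hy.
have N0 f : (0 < count_mem f (glue (Step d h s j) (Step d h' s' j)))%N -> -1 <= f j <= 1.
  rewrite -has_count has_pred1 => hf.
  have := @glue_range _ d j 0 2 _ _ f _ _ hf; rewrite eqxx; apply => a.
    apply: (@tens_range _ j 0 2 0 0) => b; rewrite side_step_same => hb.
      by rewrite (Hj _ _ hb).
    by rewrite (Hj' _ _ hb).
  by apply: (@tens_range _ j 0 1 0 1) => b /side_step_arc;
    [move/(_ D0)|move/(_ D')]; case: (d).
(* The exponents of [j] lie between -1 and 1, so both neighbours of [e] occur only if [e] has
   exponent 0 at [j]. *)
have [->//|Np] := posnP (count_mem (e - unit_exp j)%R (glue (Step d h s j) (Step d h' s' j))).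
have [->|Np'] := posnP (count_mem (e + unit_exp j)%R (glue (Step d h s j) (Step d h' s' j))).
  by rewrite muln0.
have ej : e j = 0.
  by have := N0 _ Np; have := N0 _ Np'; rewrite !ffunE eqxx; move: (e j) => x; clear; lia.
(* No side of [h] or [h'] contains [j]; the explicit test on its exponent lets the terms of the
   wrong degree reduce to 0. *)
pose c b b' (a : {ffun 'I_n -> int}) :=
  if a j == 0 then count_mem a (tens (side h b) (side h' b')) else 0%N.
have Zc b b' (a : {ffun 'I_n -> int}) : count_mem a (tens (side h b) (side h' b')) = c b b' a.
  by rewrite /c; case: eqVneq => [//|/Z].
move: Np Np'; rewrite !(glueE d) [last_arc _]/= !side_step_same !count_side_tens !count_tens_side.
rewrite !Zc /c {Zc c}.
rewrite !ffunE !label_expE ej eqxx (negPf jh) (negPf jh') (negPf sj) (negPf sj') /= {Z N0}.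
rewrite !addn0 !add0n.
(* [g] is [e] multiplied by both denominators, where the numerators of the divided terms are read
   off. *)
pose g := e + unit_exp (last_arc h) + unit_exp (last_arc h').
have E1 : e - unit_exp j + unit_exp j = e by rewrite subrK.
have E2 : e + unit_exp j + unit_exp j - unit_exp j + unit_exp (last_arc h) - unit_exp j
          + unit_exp (last_arc h') = g by apply/ffunP => i; rewrite !ffunE; ring.
have E3 : e + unit_exp j - label_exp s + unit_exp (last_arc h) - unit_exp j
          + unit_exp (last_arc h') = g - label_exp s by apply/ffunP => i; rewrite !ffunE; ring.
have E4 : e + unit_exp j - unit_exp j + unit_exp (last_arc h) - label_exp s'
          + unit_exp (last_arc h') = g - label_exp s' by apply/ffunP => i; rewrite !ffunE; ring.
have E5 : e - label_exp s + unit_exp (last_arc h) - label_exp s' + unit_exp (last_arc h')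
          = g - label_exp s - label_exp s' by apply/ffunP => i; rewrite !ffunE; ring.
rewrite E1 E2 E3 E4 E5 {E1 E2 E3 E4 E5} => _ _.
have [->|gp] := posnP (count_mem g (tens (side h (~~ d)) (side h' (~~ d)))).
  by rewrite muln0.
move: D; rewrite distinct_cons => /andP[_] /= D.
(* [A] holds the variables of [h], its last arc included; the sides of [h'] avoid it. *)
pose A : pred 'I_n := [pred i | Some i \in Some (last_arc h) :: labels h].
have S1 b (a : {ffun 'I_n -> int}) i : a \in side h b -> ~~ A i -> a i = 0.
  rewrite /A /= inE negb_or => ha /andP[ih il].
  by apply: side_support ha => //; apply: contraNneq ih => ->.
have inA i : A i -> [/\ i != last_arc h', Some i \notin labels h' & s' != Some i].
  move=> Ai; have : Some i \notin [:: s', Some (last_arc h') & labels h'].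
    apply: (@distinct_cat_notin _ (s :: Some (last_arc h) :: labels h) _ i D).
    by rewrite inE orbC; apply/orP; left.
  rewrite !inE !negb_or => /and3P[si ih il]; split=> //; last by rewrite eq_sym.
have S2 b (a : {ffun 'I_n -> int}) i : a \in side h' b -> A i -> a i = 0.
  by move=> ha /inA[? ? _]; apply: side_support ha.
have F b b' a := @count_tens_disjoint _ A (side h b) (side h' b') a (S1 b) (S2 b').
(* The undivided term P P' does not meet R R': on [A], some monomial would lie in P and its product
   with the last arc of [h] in R, against [side_no_common]. *)
have -> : count_mem e (tens (side h d) (side h' d)) = 0%N.
  apply/eqP; rewrite -leqn0 leqNgt; apply/negP; rewrite F muln_gt0 => /andP[].
  rewrite -has_count has_pred1 => /(side_no_common Dh)/negP H _; apply: H.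
  have <- : restrict A g = restrict A e + unit_exp (last_arc h).
    apply/ffunP => i; rewrite !ffunE.
    case: ifPn => [/inA[/negPf-> _ _]|]; first by rewrite addr0.
    by rewrite /A /= inE negb_or (inj_eq Some_inj) => /andP[/negPf->].
  by move: gp; rewrite F muln_gt0 -has_count has_pred1 => /andP[].
(* The diagonals [s] and [s'] occur in neither factor. *)
have T i b b' (a : {ffun 'I_n -> int}) :
    s = Some i \/ s' = Some i -> (0 < count_mem a (tens (side h b) (side h' b')))%N ->
    a i = 0.
  move=> si; rewrite -has_count has_pred1 => /allpairsP[[x y] /= [hx hy ->]].
  have nA : ~~ A i.
    rewrite /A /= inE negb_or; case: si => [si|/eqP si].
      by rewrite -si sh si sl.
    by rewrite -negb_or; apply/negP => /inA[_ _]; rewrite si.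
  rewrite ffunE (S1 _ _ _ hx nA) (side_support _ _ hy) //; case: si => [si|si].
  - have := @distinct_cat_notin _ (s :: Some (last_arc h) :: labels h) _ i D.
    rewrite -si mem_head => /(_ isT); rewrite !inE !negb_or => /and3P[_ + _].
    by rewrite si; apply: contraNneq => ->.
  - by apply: contraNneq sh' => <-; rewrite si.
  - have := @distinct_cat_notin _ (s :: Some (last_arc h) :: labels h) _ i D.
    by rewrite -si mem_head => /(_ isT); rewrite !inE !negb_or => /and3P[].
  - exact: sl'.
(* A diagonal [s] or [s'] has exponent 0 in [g], hence a negative one after the division, which [T]
   excludes. *)
have Z2 i : s = Some i \/ s' = Some i ->
    count_mem (g - label_exp s - label_exp s')%R (tens (side h d) (side h' d)) = 0%N.
  move=> si; apply/eqP; rewrite -leqn0 leqNgt; apply/negP => /(T _ _ _ _ si).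
  have := T _ _ _ _ si gp; rewrite /g !ffunE => ->; rewrite !label_expE.
  by case: si => ->; rewrite eqxx; case: (_ == _).
rewrite add0n; case Es: s => [i|]; first by rewrite -Es (Z2 i) ?mul0n //; left.
case Es': s' => [i|]; first by rewrite -Es -Es' (Z2 i) ?mul0n //; right.
rewrite /= !subr0 !F.
move: (count _ _) (count _ _) (count _ _) (count _ _) => p q r u.
(* The product of P P' and R R' regroups as that of P R' and R P', which leaves x y <= (x + y)^2. *)
rewrite (_ : u * r * (q * p) = (u * p) * (q * r))%N; last by ring.
by rewrite sqrnD mul2n -addnn addnCA leq_addr.
Qed.


(** The two sides of a [Base] walk do not contain [t], so only one factor can; after the division
    its exponents are -1 and 0. *)
Lemma log_concave_glue_base (n : nat) (u w : option 'I_n) (t : 'I_n) (h : walk n) :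
  glueable (Base u w t) h -> log_concave_along t (glue (Base u w t) h).
Proof.
move=> G; have D0 := glueable_l G; have D := glueable_l (glueableC G).
case: G => /= ht _; apply: (@log_concave_along_narrow _ _ (-1)) => e.
have Hr b (a : {ffun 'I_n -> int}) : a \in side h b -> 0 <= a t <= 1.
  by rewrite ht; apply: side_range; rewrite ?arc_notin_crossed.
have Hl b (a : {ffun 'I_n -> int}) : a \in side (Base u w t) b -> 0 <= a t <= 0.
  move: D0; rewrite distinct_cons !inE /= negb_or => /andP[/andP[tu tw] _] /eqP->.
  by rewrite label_expE; case: b; rewrite eq_sym ?(negPf tu) ?(negPf tw).
by move/(@glue_range _ true t 0 1); rewrite eqxx; apply => a;
  apply: (@tens_range _ t 0 0 0 1) => b hb; first [exact: Hl hb | exact: Hr hb].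
Qed.

(** With opposite flags the two triangles form a fan at one end of the arc. Each of the two products
    then contains the arc in one factor only, and its exponents are -1 and 0. *)
Lemma log_concave_glue_arc (n : nat) (h h' : walk n) :
  glueable h h' -> log_concave_along (last_arc h) (glue h h').
Proof.
case: h => [u w t|d h s t]; first exact: log_concave_glue_base.
case: h' => [u w t'|d' h' s' t'] G.
  have /= E := G.1; move: G => /glueableC; rewrite -E => G.
  apply: log_concave_along_perm (log_concave_glue_base G).
  exact: glueC.
have /= E := G.1; move: G; rewrite -E => G.
have [dd'|dd'] := eqVneq d d'; first by move: G; rewrite -dd'; exact: log_concave_glue_zigzag.
have {dd'}Ed : d' = ~~ d by case: d d' dd' {G} => [] [].
move: G; rewrite {}Ed => G; have D0 := glueable_l G; have D := glueable_l (glueableC G).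
apply: (@log_concave_along_narrow _ _ (-1)) => e.
move/(@glue_range _ d t 0 1); rewrite eqxx; apply => a.
  by apply: (@tens_range _ t 0 0 0 1) => b; move/side_step_arc=> H;
    [move: (H D0)|move: (H D)]; case: (d).
by apply: (@tens_range _ t 0 1 0 0) => b; move/side_step_arc=> H;
    [move: (H D0)|move: (H D)]; case: (d).
Qed.

(* The cut may be moved to any crossed arc, by [glue_move]. *)
Lemma log_concave_glue_crossed (n : nat) (j : 'I_n) (h h' : walk n) :
  glueable h h' -> j \in crossed h -> log_concave_along j (glue h h').
Proof.
elim: h h' => [//|d h IH s t] h' G.
have /= E := G.1; move: G; rewrite E => /[dup] /glueable_move G _.
rewrite inE => jc; apply: log_concave_along_perm.
  by rewrite perm_sym; exact: glue_move.
case/orP: jc => [/eqP->|]; first exact: log_concave_glue_arc.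
exact: IH.
Qed.

Lemma log_concave_glue (n : nat) (j : 'I_n) (h h' : walk n) :
  glueable h h' -> log_concave_along j (glue h h').
Proof.
move=> G; have [->|jh] := eqVneq j (last_arc h); first exact: log_concave_glue_arc.
have [jc|jc] := boolP (j \in crossed h); first exact: log_concave_glue_crossed.
have [jc'|jc'] := boolP (j \in crossed h'); last exact: log_concave_glue_narrow.
apply: log_concave_along_perm (log_concave_glue_crossed (glueableC G) jc').
by apply: glueC; case: G.
Qed.

(** * Evaluation of exponents in a field *)

Definition label_val (n : nat) (K : fieldType) (x : 'I_n -> K) (l : option 'I_n) : K :=
  oapp x 1 l.

Definition monom_val (n : nat) (K : fieldType) (x : 'I_n -> K)
    (e : {ffun 'I_n -> int}) : K := \prod_(i < n) x i ^ e i.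

Definition exps_val (n : nat) (K : fieldType) (x : 'I_n -> K)
    (s : seq {ffun 'I_n -> int}) : K := \sum_(e <- s) monom_val x e.

Lemma monom_valD (n : nat) (K : fieldType) (x : 'I_n -> K)
    (e e' : {ffun 'I_n -> int}) :
  (forall i, x i != 0) -> monom_val x (e + e') = monom_val x e * monom_val x e'.
Proof.
move=> x0; rewrite /monom_val -big_split; apply: eq_bigr => i _.
by rewrite ffunE expfzDr.
Qed.

Lemma monom_val0 (n : nat) (K : fieldType) (x : 'I_n -> K) : monom_val x 0 = 1.
Proof. by apply: big1 => i _; rewrite ffunE expr0z. Qed.

Lemma monom_valN (n : nat) (K : fieldType) (x : 'I_n -> K) (e : {ffun 'I_n -> int}) :
  monom_val x (- e) = (monom_val x e)^-1.
Proof.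
rewrite /monom_val (big_morph _ (@invfM K) (invr1 K)); apply: eq_bigr => i _.
by rewrite ffunE -invr_expz.
Qed.

Lemma monom_val_label (n : nat) (K : fieldType) (x : 'I_n -> K) (l : option 'I_n) :
  monom_val x (label_exp l) = label_val x l.
Proof.
case: l => [j|]; last exact: monom_val0.
rewrite /monom_val /= (bigD1 j) //= ffunE eqxx expr1z big1 ?mulr1 // => i ij.
by rewrite ffunE (negPf ij) expr0z.
Qed.

Lemma exps_val_cat (n : nat) (K : fieldType) (x : 'I_n -> K)
    (s s' : seq {ffun 'I_n -> int}) :
  exps_val x (s ++ s') = exps_val x s + exps_val x s'.
Proof. exact: big_cat. Qed.

Lemma exps_val_shift (n : nat) (K : fieldType) (x : 'I_n -> K)
    (c : {ffun 'I_n -> int}) (s : seq {ffun 'I_n -> int}) :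
  (forall i, x i != 0) -> exps_val x (shift c s) = monom_val x c * exps_val x s.
Proof.
move=> x0; rewrite /exps_val big_map mulr_sumr; apply: eq_bigr => e _.
exact: monom_valD.
Qed.

Lemma exps_val_tens (n : nat) (K : fieldType) (x : 'I_n -> K)
    (s s' : seq {ffun 'I_n -> int}) :
  (forall i, x i != 0) -> exps_val x (tens s s') = exps_val x s * exps_val x s'.
Proof.
move=> x0; rewrite /exps_val /tens big_allpairs_dep /= mulr_suml; apply: eq_bigr => e _.
by rewrite mulr_sumr; apply: eq_bigr => e' _; exact: monom_valD.
Qed.

Lemma side_step_val (n : nat) (K : fieldType) (x : 'I_n -> K) (d : bool)
    (h : walk n) (s : option 'I_n) (t : 'I_n) :
  (forall i, x i != 0) ->
  exps_val x (side (Step d h s t) (~~ d)) =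
  (label_val x s * exps_val x (side h d)
   + x t * exps_val x (side h (~~ d))) / x (last_arc h).
Proof.
move=> x0; rewrite /= (_ : (~~ d == d) = false); last by case: d.
rewrite exps_val_cat !exps_val_shift // !monom_valD // !monom_valN.
by rewrite !(monom_val_label x (Some _)) monom_val_label /=; field.
Qed.

Lemma glue_val (n : nat) (K : fieldType) (x : 'I_n -> K) (h h' : walk n) :
  (forall i, x i != 0) ->
  exps_val x (glue h h') =
  (exps_val x (side h true) * exps_val x (side h' true)
   + exps_val x (side h false) * exps_val x (side h' false)) / x (last_arc h).
Proof.
move=> x0; rewrite /glue exps_val_shift // exps_val_cat !exps_val_tens // monom_valN.
by rewrite (monom_val_label x (Some _)) mulrC.
Qed.

(** The multiplicities serve as rational coefficients; they are non-negative, and one is positive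
    because [s] is not empty. *)
Lemma log_concave_of_exps (n : nat) (x : {ffun 'I_n -> ambient n})
    (s : seq {ffun 'I_n -> int}) :
  s != [::] -> (forall j, log_concave_along j s) ->
  log_concave_in x (exps_val x s).
Proof.
move=> s0 lc; pose f : laurent rat n := [fsfun e in [fset e in s]%fset => (count_mem e s)%:R].
have fE e : f e = (count_mem e s)%:R.
  rewrite fsfunE inE; case: ifPn => // /count_memPn->; by [].
exists f; split; last split.
- rewrite /laurent_eval.
  have P : perm_eq (finsupp f) (undup s).
    apply: uniq_perm; rewrite ?undup_uniq ?fset_uniq // => e.
    rewrite mem_finsupp fE mem_undup pnatr_eq0 -lt0n -has_count has_pred1 //.
  rewrite (perm_big _ P) /exps_val -[RHS]big_undup_iterop_count; apply: eq_bigr => e _.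
  rewrite -/(monom_val x e) fE /ratconst mpolyC_nat rmorph_nat mulr_natl.
  rewrite Monoid.iteropE; elim: (count_mem e s) => [|k IH]; first exact: mulr0n.
  by rewrite mulrS IH iterS.
- have [e es] : exists e, e \in s by case: (s) s0 => // e s' _; exists e; exact: mem_head.
  by exists e; rewrite fE pnatr_eq0 -lt0n -has_count has_pred1.
- by move=> e; rewrite fE ler0n.
- by move=> j e; rewrite !fE -natrM -natrX ler_nat; exact: lc.
Qed.



Lemma distinct_cat (T : eqType) (s s' : seq (option T)) :
  distinct s -> distinct s' ->
  (forall i, Some i \in s -> Some i \notin s') -> distinct (s ++ s').
Proof.
rewrite /distinct pmap_cat cat_uniq => -> -> H; rewrite andbT /=.
by apply/hasPn => i; rewrite !mem_pmap_id; apply: contraTN => /H.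
Qed.

Lemma perm_rot_cons (T : eqType) (a b c : T) (s : seq T) :
  perm_eq [:: a, b, c & s] [:: b, c, a & s].
Proof. by rewrite -(perm_catCA [:: b; c] [:: a] s). Qed.

Lemma perm_rev_cons (T : eqType) (a b c : T) (s : seq T) :
  perm_eq [:: a, b, c & s] [:: c, b, a & s].
Proof.
by rewrite (perm_catCA [:: a; b] [:: c] s) perm_cons (perm_catCA [:: a] [:: b] s).
Qed.

Lemma perm_move_cons (T : eqType) (a b c : T) (s s' : seq T) :
  perm_eq [:: a, b, c & s ++ s'] (b :: (c :: s) ++ a :: s').
Proof. by rewrite -(perm_catCA [:: b, c & s] [:: a] s'). Qed.

Lemma distinct1 (T : eqType) (l : option T) : distinct [:: l].
Proof. by case: l. Qed.

Lemma exps_val_label (n : nat) (K : fieldType) (x : 'I_n -> K) (l : option 'I_n) :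
  exps_val x [:: label_exp l] = label_val x l.
Proof. by rewrite /exps_val big_seq1 monom_val_label. Qed.

(** * Triangulations as binary trees *)

(* A tree at position p triangulates the polygon with the consecutive vertices   *)
(* p, ..., p + leaves: each leaf is an edge, and a node labelled m with subtrees *)
(* l and r is the diagonal m together with the triangle that it forms with the   *)
(* root diagonals of l and r. The base edge of the whole polygon has label None. *)
Inductive tree (n : nat) := Leaf | Node (m : option 'I_n) (l r : tree n).
Arguments Leaf {n}.

Definition root_label (n : nat) (T : tree n) : option 'I_n :=
  if T is Node m _ _ then m else None.

Fixpoint leaves (n : nat) (T : tree n) : nat :=
  if T is Node _ l r then (leaves l + leaves r)%N else 1%N.

Fixpoint inner (n : nat) (T : tree n) : seq (option 'I_n) :=
  if T is Node m l r then m :: inner l ++ inner r else [::].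

Definition minor (K : fieldType) (v : nat -> K * K) (a b : nat) : K :=
  (v a).1 * (v b).2 - (v a).2 * (v b).1.

(** A flat list, so that a flip becomes the replacement of a single entry up to permutation. *)
Fixpoint sides (n : nat) (K : fieldType) (v : nat -> K * K) (p : nat) (T : tree n) :
    seq (option 'I_n * K) :=
  (root_label T, minor v p (p + leaves T)) ::
  if T is Node _ l r then sides v p l ++ sides v (p + leaves l) r else [::].

Definition realizes (n : nat) (K : fieldType) (x : 'I_n -> K) (v : nat -> K * K)
    (p : nat) (T : tree n) : bool :=
  all (fun c => label_val x c.1 == c.2) (sides v p T).

Lemma leaves_gt0 (n : nat) (T : tree n) : (0 < leaves T)%N.
Proof. by elim: T => //= m l IHl r IHr; rewrite addn_gt0 IHl. Qed.

Lemma root_inner (n : nat) (T : tree n) (i : 'I_n) :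
  root_label T = Some i -> Some i \in inner T.
Proof. by case: T => //= m l r ->; exact: mem_head. Qed.

Lemma plucker (K : fieldType) (v : nat -> K * K) (a b c d : nat) :
  minor v a c * minor v b d = minor v a b * minor v c d + minor v a d * minor v b c.
Proof. by rewrite /minor; ring. Qed.

Lemma realizes_root (n : nat) (K : fieldType) (x : 'I_n -> K) (v : nat -> K * K)
    (p : nat) (T : tree n) :
  realizes x v p T -> label_val x (root_label T) = minor v p (p + leaves T).
Proof. by rewrite /realizes; case: T => [|m l r] /= /andP[/eqP]. Qed.

Lemma realizes_node (n : nat) (K : fieldType) (x : 'I_n -> K) (v : nat -> K * K)
    (p : nat) (m : option 'I_n) (l r : tree n) :
  realizes x v p (Node m l r) = [&& label_val x m == minor v p (p + (leaves l + leaves r)),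
    realizes x v p l & realizes x v (p + leaves l) r].
Proof. by rewrite /realizes /= all_cat. Qed.

Lemma inner_node (n : nat) (m : option 'I_n) (l r : tree n) :
  uniq (inner (Node m l r)) ->
  [/\ uniq (inner l), uniq (inner r), m \notin inner l, m \notin inner r
    & forall k, k \in inner l -> k \notin inner r].
Proof.
rewrite /= mem_cat negb_or cat_uniq => /and3P[/andP[ml mr] ul /andP[/hasPn H ur]].
by split=> // k kl; apply/negP => /H; rewrite /= kl.
Qed.

Lemma realizes_last_arc (n : nat) (K : fieldType) (x : 'I_n -> K) (v : nat -> K * K)
    (p : nat) (T : tree n) (t : 'I_n) :
  realizes x v p T -> root_label T = Some t -> x t = minor v p (p + leaves T).
Proof. by move=> /realizes_root <- ->. Qed.

(** The walk starts at the vertex [a] and leaves the polygon of [T] through its root diagonal.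
    Minors are antisymmetric; they are taken with increasing indices when [a] lies inside. *)
Definition walk_to (n : nat) (K : fieldType) (x : 'I_n -> K) (v : nat -> K * K)
    (p : nat) (T : tree n) (a : nat) (h : walk n) :=
  [/\ root_label T = Some (last_arc h),
      forall i, Some i \in labels h -> Some i \in behead (inner T),
      distinct (Some (last_arc h) :: labels h),
      exps_val x (side h true) = minor v p a
    & exps_val x (side h false) = minor v a (p + leaves T)].

Lemma walk_toP (n : nat) (K : fieldType) (x : 'I_n -> K) (v : nat -> K * K)
    (p : nat) (T : tree n) (a : nat) (h : walk n) (i : 'I_n) :
  walk_to x v p T a h -> Some i \in Some (last_arc h) :: labels h -> Some i \in inner T.
Proof.
move=> [rT sub _ _ _]; rewrite inE => /orP[/eqP[->]|/sub]; first exact: root_inner.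
exact: mem_behead.
Qed.

Lemma distinct_stepI (n : nat) (d : bool) (h : walk n) (s : option 'I_n) (t : 'I_n) :
  distinct (Some (last_arc h) :: labels h) -> s != Some t ->
  (forall i, s = Some i -> Some i \notin Some (last_arc h) :: labels h) ->
  Some t \notin Some (last_arc h) :: labels h ->
  distinct (Some t :: labels (Step d h s t)).
Proof.
move=> D st sh th; rewrite distinct_cons [labels _]/= in_cons negb_or th.
rewrite [Some t == s]eq_sym st /= distinct_cons D andbT.
by case: s sh {st} => //= i; apply.
Qed.

(** If [a] is the apex of the root triangle, the walk is a [Base]. Otherwise a walk inside one
    subtree is prolonged across the root of that subtree, and the new side is computed by the
    Pluecker relation. *)
Lemma ex_walk_to (n : nat) (K : fieldType) (x : 'I_n -> K) (v : nat -> K * K)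
    (p : nat) (T : tree n) (a : nat) :
  (forall i, x i != 0) -> realizes x v p T -> None \notin inner T -> uniq (inner T) ->
  (p < a < p + leaves T)%N -> exists h, walk_to x v p T a h.
Proof.
move=> x0; elim: T p => [|m l IHl r IHr] p; first by rewrite /= addn1; lia.
rewrite realizes_node => /and3P[/eqP xm xl xr].
case: m xm => [m|]; last by [].
move=> xm; rewrite [_ \notin _]/= in_cons mem_cat !negb_or => /and3P[_ Nl Nr].
move=> /inner_node [ul ur ml mr lr] pa.
have [ac|ca|ac] := ltngtP a (p + leaves l)%N.
- have [|h hP] := IHl _ xl Nl ul; first by lia.
  exists (Step true h (root_label r) m); case: (hP) => [rl sub D Ht Hf].
  have xt := realizes_last_arc xl rl.
  split=> //.
  + move=> i /=; rewrite in_cons => /orP[/eqP/esym/root_inner ri|/(walk_toP hP) il].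
      by rewrite mem_cat ri orbT.
    by rewrite mem_cat il.
  + apply: distinct_stepI => //.
    * by apply: contraNneq mr => /root_inner.
    * by move=> i /root_inner ir; apply: contraTN ir => /(walk_toP hP)/lr.
    * by apply: contra ml => /(walk_toP hP).
  + rewrite (@side_step_val _ _ _ true) // Ht Hf (realizes_root xr) -[x m]/(label_val x (Some m)).
    rewrite xm addnA; apply: (mulIf (x0 (last_arc h))); rewrite divfK ?x0 // xt.
    by rewrite [RHS]mulrC [RHS]plucker; ring.
- have [|h hP] := IHr _ xr Nr ur; first by move: pa; rewrite /=; lia.
  exists (Step false h (root_label l) m); case: (hP) => [rr sub D Ht Hf].
  have xt := realizes_last_arc xr rr.
  split=> //.
  + move=> i /=; rewrite in_cons => /orP[/eqP/esym/root_inner ri|/(walk_toP hP) il].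
      by rewrite mem_cat ri.
    by rewrite mem_cat il orbT.
  + apply: distinct_stepI => //.
    * by apply: contraNneq ml => /root_inner.
    * by move=> i /root_inner/lr ir; apply: contra ir => /(walk_toP hP).
    * by apply: contra mr => /(walk_toP hP).
  + rewrite (@side_step_val _ _ _ false) // Ht Hf (realizes_root xl) -[x m]/(label_val x (Some m)).
    rewrite xm addnA; apply: (mulIf (x0 (last_arc h))); rewrite divfK ?x0 // xt.
    by rewrite [RHS]plucker; ring.
  + by rewrite side_step_same Hf /= addnA.
exists (Base (root_label l) (root_label r) m); split=> //.
- move=> i; rewrite !inE => /orP[]/eqP/esym/root_inner; rewrite mem_cat => -> //.
  by rewrite orbT.
- rewrite -[_ :: _]/([:: Some m] ++ [:: root_label l] ++ [:: root_label r]).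
  apply: distinct_cat => //; last first.
    move=> i; rewrite !inE negb_or => /eqP[->].
    by apply/andP; split; [apply: contraNneq ml|apply: contraNneq mr] => /esym/root_inner.
  apply: distinct_cat; [exact: distinct1|exact: distinct1|move=> i].
  rewrite !inE => /eqP/esym/root_inner/lr; apply: contraNneq => /esym.
  exact: root_inner.
- by rewrite exps_val_label (realizes_root xl) ac.
- by rewrite exps_val_label (realizes_root xr) ac /= addnA.
Qed.

Definition log_concave_expansion (n : nat) (K : fieldType) (x : 'I_n -> K) (y : K) :=
  exists2 s, exps_val x s = y & forall j, log_concave_along j s.

Lemma log_concave_expansion_label (n : nat) (K : fieldType) (x : 'I_n -> K)
    (l : option 'I_n) : log_concave_expansion x (label_val x l).
Proof.
exists [:: label_exp l]; first exact: exps_val_label.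
move=> j; apply: (@log_concave_along_narrow _ _ (label_exp l j)) => e.
by rewrite inE => /eqP->; rewrite lexx lerDl.
Qed.

Lemma log_concave_expansion_glue (n : nat) (K : fieldType) (x : 'I_n -> K)
    (h h' : walk n) (y : K) :
  (forall i, x i != 0) -> last_arc h = last_arc h' ->
  distinct (Some (last_arc h) :: labels h ++ labels h') ->
  exps_val x (side h true) * exps_val x (side h' true)
   + exps_val x (side h false) * exps_val x (side h' false) = y * x (last_arc h) ->
  log_concave_expansion x y.
Proof.
move=> x0 E D Ey; exists (glue h h'); last by move=> j; apply: log_concave_glue.
by rewrite glue_val // Ey mulfK.
Qed.

(** The induction descends to a subtree whose apex separates [a] from [b] strictly. There the
    segment is the root itself, or it meets the root triangle at a vertex, or it crosses two sides
    of this triangle. *)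
Lemma log_concave_minor (n : nat) (K : fieldType) (x : 'I_n -> K) (v : nat -> K * K)
    (p : nat) (T : tree n) (a b : nat) :
  (forall i, x i != 0) -> realizes x v p T -> None \notin behead (inner T) ->
  uniq (inner T) -> (p <= a)%N -> (a < b)%N -> (b <= p + leaves T)%N ->
  log_concave_expansion x (minor v a b).
Proof.
move=> x0; elim: T p => [|m l IHl r IHr] p xT NT uT pa ab bq.
  have [-> ->] : a = p /\ b = (p + leaves (@Leaf n))%N by move: bq; rewrite /=; lia.
  rewrite -(realizes_root xT); exact: log_concave_expansion_label.
move: (xT); rewrite realizes_node => /and3P[/eqP xm xl xr].
have [ul ur ml mr lr] := inner_node uT.
move: NT; rewrite [behead _]/= mem_cat negb_or => /andP[Nl Nr].
have Nbl : None \notin behead (inner l) by apply: contra Nl; exact: mem_behead.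
have Nbr : None \notin behead (inner r) by apply: contra Nr; exact: mem_behead.
have [bl|lb] := leqP b (p + leaves l); first by apply: IHl xl _ _ _ _ _.
have [ra|al] := leqP (p + leaves l) a.
  by apply: (IHr _ xr) => //; move: bq; rewrite /= addnA.
rewrite [leaves _]/= addnA in bq; rewrite addnA in xm.
have Dm s : (forall i, Some i \in s -> Some i \in inner l ++ inner r) ->
    distinct s -> distinct (m :: s).
  move=> ss Ds; rewrite distinct_cons Ds andbT; case: m {xT uT xm} ml mr => //= m ml mr.
  by apply/negP => /ss; rewrite mem_cat (negPf ml) (negPf mr).
(* Here [a] is a vertex of the root triangle, which thus is the first triangle of a [Base] walk. *)
have [pa'|ap] := leqP a p.
  have {pa pa'}-> : a = p by apply/eqP; rewrite eqn_leq pa pa'.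
  have [bq'|qb] := leqP (p + leaves l + leaves r) b.
    have -> : b = (p + leaves l + leaves r)%N by apply/eqP; rewrite eqn_leq bq bq'.
    by rewrite -xm; exact: log_concave_expansion_label.
  have [|h hP] := ex_walk_to x0 xr Nr ur (a := b); first by rewrite lb qb.
  have [rr sub D Ht Hf] := hP; have xt := realizes_last_arc xr rr.
  apply: (@log_concave_expansion_glue _ _ _ (Base m (root_label l) (last_arc h)) h) => //.
    rewrite (@perm_distinct _ _ (m :: root_label l :: Some (last_arc h) :: labels h)); last first.
      exact: perm_rot_cons.
    apply: Dm => [i|]; first rewrite in_cons => /orP[/eqP/esym/root_inner|/(walk_toP hP)] il.
    - by rewrite mem_cat il.
    - by rewrite mem_cat il orbT.
    rewrite -cat1s; apply: distinct_cat => [||i]; rewrite ?distinct1 //.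
    by rewrite inE => /eqP/esym/root_inner/lr; apply: contra => /(walk_toP hP).
  rewrite !exps_val_label [last_arc _]/= xt xm (realizes_root xl) Ht Hf.
  by rewrite [RHS]plucker; ring.
have [|h hP] := ex_walk_to x0 xl Nl ul (a := a); first by rewrite ap al.
have [rl sub D Ht Hf] := hP; have xt := realizes_last_arc xl rl.
have [bq'|qb] := leqP (p + leaves l + leaves r) b.
  have {bq bq'}-> : b = (p + leaves l + leaves r)%N by apply/eqP; rewrite eqn_leq bq bq'.
  apply: (@log_concave_expansion_glue _ _ _ (Base (root_label r) m (last_arc h)) h) => //.
    rewrite (@perm_distinct _ _ (m :: root_label r :: Some (last_arc h) :: labels h)); last first.
      exact: perm_rev_cons.
    apply: Dm => [i|]; first rewrite in_cons => /orP[/eqP/esym/root_inner|/(walk_toP hP)] il.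
    - by rewrite mem_cat il orbT.
    - by rewrite mem_cat il.
    rewrite -cat1s; apply: distinct_cat => [||i]; rewrite ?distinct1 //.
    by rewrite inE => /eqP/esym/root_inner; apply: contraL => /(walk_toP hP)/lr.
  rewrite !exps_val_label [last_arc _]/= xt xm (realizes_root xr) Ht Hf.
  by rewrite [RHS]mulrC [RHS]plucker; ring.
(* Both ends lie strictly inside their subpolygons: the walk from [a] crosses the root triangle,
   keeping the apex, and meets the walk from [b]. *)
have [|h' hP'] := ex_walk_to x0 xr Nr ur (a := b); first by rewrite lb qb.
have [rr sub' D' Ht' Hf'] := hP'; have xt' := realizes_last_arc xr rr.
apply: (@log_concave_expansion_glue _ _ _ (Step false h m (last_arc h')) h') => //.
  rewrite (@perm_distinct _ _ (m :: (Some (last_arc h) :: labels h)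
                                ++ (Some (last_arc h') :: labels h'))); last first.
    exact: perm_move_cons.
  apply: Dm => [i|].
    by rewrite !mem_cat => /orP[/(walk_toP hP)->|/(walk_toP hP')->]; rewrite ?orbT.
  apply: distinct_cat => // i /(walk_toP hP)/lr; apply: contra; exact: walk_toP hP'.
rewrite side_step_same (@side_step_val _ _ _ false) // Ht Hf Ht' Hf' xm [last_arc _]/=.
apply: (mulIf (x0 (last_arc h))); rewrite mulrDl mulrAC divfK // xt xt'.
(* [Ea] identifies the new side as the minor from [a] to the last vertex; [Eb] then glues at the
   root of [r]. *)
have Ea := plucker v p a (p + leaves l) (p + leaves l + leaves r).
have Eb := plucker v a (p + leaves l) b (p + leaves l + leaves r).
rewrite [X in X * minor v (p + leaves l) b](_ : _ =
    minor v p (p + leaves l) * minor v a (p + leaves l + leaves r)); last first.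
  by rewrite Ea; ring.
by rewrite Eb; ring.
Qed.



(** * Flips and mutations *)

(** The wedge of the basis vectors of [l] and [l'], where [None] stands for the zero vector. *)
Definition label_form (n : nat) (l l' : option 'I_n) (i j : 'I_n) : int :=
  (l == Some i)%:Z * (l' == Some j)%:Z - (l == Some j)%:Z * (l' == Some i)%:Z.

Definition triangle_form (n : nat) (a b c : option 'I_n) (i j : 'I_n) : int :=
  label_form a b i j + label_form b c i j + label_form c a i j.

(** The signed adjacency matrix of the triangulation: every node is one triangle and contributes an
    oriented 3-cycle. *)
Fixpoint tree_form (n : nat) (T : tree n) (i j : 'I_n) : int :=
  if T is Node m l r then
    triangle_form m (root_label l) (root_label r) i j + tree_form l i j + tree_form r i j
  else 0.

(** This holds for the contribution of the triangles without side [k], which mutation at [k] does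
    not change. *)
Definition isolated (n : nat) (k : 'I_n) (M : 'I_n -> 'I_n -> int) :=
  forall i, M k i = 0 /\ M i k = 0.

Lemma isolatedD (n : nat) (k : 'I_n) (M M' : 'I_n -> 'I_n -> int) :
  isolated k M -> isolated k M' -> isolated k (fun i j => M i j + M' i j).
Proof. by move=> H H' i; have [-> ->] := H i; have [-> ->] := H' i. Qed.

Lemma isolated_triangle (n : nat) (k : 'I_n) (a b c : option 'I_n) :
  a != Some k -> b != Some k -> c != Some k -> isolated k (triangle_form a b c).
Proof.
move=> /negPf ak /negPf bk /negPf ck i.
by rewrite /triangle_form /label_form ak bk ck !mulr0.
Qed.

Lemma root_neq (n : nat) (T : tree n) (k : 'I_n) :
  Some k \notin inner T -> root_label T != Some k.
Proof. by apply: contraNneq => /root_inner. Qed.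

Lemma isolated_tree (n : nat) (k : 'I_n) (T : tree n) :
  Some k \notin inner T -> isolated k (tree_form T).
Proof.
elim: T => [|m l IHl r IHr] //=; rewrite in_cons mem_cat !negb_or => /and3P[mk lk rk].
apply: isolatedD; last exact: IHr.
apply: isolatedD; last exact: IHl.
by apply: isolated_triangle; rewrite ?root_neq // eq_sym.
Qed.

(* [T'] arises from [T] by a flip at [k] inside the quadrilateral with sides [a, b, c, d]. *)
Definition flipped (n : nat) (K : fieldType) (v : nat -> K * K) (p : nat) (k : 'I_n)
    (T T' : tree n) : Prop :=
  exists (a b c d : option 'I_n * K) (y y' : K) (rest : seq (option 'I_n * K))
         (M : 'I_n -> 'I_n -> int),
  [/\ perm_eq (sides v p T) [:: (Some k, y), a, b, c, d & rest]
       /\ perm_eq (sides v p T') [:: (Some k, y'), a, b, c, d & rest],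
      y * y' = a.2 * c.2 + b.2 * d.2,
      forall i j, tree_form T i j = triangle_form (Some k) a.1 b.1 i j
                    + triangle_form (Some k) c.1 d.1 i j + M i j,
      forall i j, tree_form T' i j = triangle_form (Some k) d.1 a.1 i j
                    + triangle_form (Some k) b.1 c.1 i j + M i j
    & isolated k M].

(** What the surrounding tree sees of a subtree; the branching may differ. *)
Definition same_shape (n : nat) (T T' : tree n) :=
  [/\ perm_eq (inner T') (inner T), root_label T' = root_label T & leaves T' = leaves T].

Lemma perm_quad_left (T : eqType) (y a b c d : T) (s s' s'' : seq T) :
  perm_eq (d :: (y :: (a :: s) ++ (b :: s')) ++ (c :: s''))
          [:: y, a, b, c, d & s ++ s' ++ s''].
Proof. by apply: eq_count_perm => e; do 3 rewrite /= ?count_cat; lia. Qed.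

Lemma perm_quad_right (T : eqType) (y a b c d : T) (s s' s'' : seq T) :
  perm_eq (d :: (a :: s) ++ (y :: (b :: s') ++ (c :: s'')))
          [:: y, a, b, c, d & s ++ s' ++ s''].
Proof. by apply: eq_count_perm => e; do 3 rewrite /= ?count_cat; lia. Qed.

Lemma perm_quad_rot (T : eqType) (y a b c d : T) (s : seq T) :
  perm_eq [:: y, a, b, c, d & s] [:: y, d, a, b, c & s].
Proof. by apply: eq_count_perm => e; rewrite /=; lia. Qed.

Lemma perm_quad_cons (T : eqType) (y a b c d m : T) (s s' s0 : seq T) :
  perm_eq s0 [:: y, a, b, c, d & s] ->
  perm_eq (m :: s0 ++ s') [:: y, a, b, c, d, m & s ++ s'].
Proof.
move=> /seq.permP P; apply: eq_count_perm => e.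
by rewrite /= count_cat P /= count_cat; lia.
Qed.

Lemma sides_root (n : nat) (K : fieldType) (v : nat -> K * K) (p : nat) (T : tree n) :
  sides v p T = (root_label T, minor v p (p + leaves T)) :: behead (sides v p T).
Proof. by case: T. Qed.

Lemma perm_sides_left (n : nat) (K : fieldType) (v : nat -> K * K) (p : nat)
    (m k : option 'I_n) (A B C : tree n) :
  perm_eq (sides v p (Node m (Node k A B) C))
    [:: (k, minor v p (p + leaves A + leaves B)),
        (root_label A, minor v p (p + leaves A)),
        (root_label B, minor v (p + leaves A) (p + leaves A + leaves B)),
        (root_label C, minor v (p + leaves A + leaves B) (p + leaves A + leaves B + leaves C)),
        (m, minor v p (p + leaves A + leaves B + leaves C))
      & behead (sides v p A) ++ behead (sides v (p + leaves A) B)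
        ++ behead (sides v (p + leaves A + leaves B) C)].
Proof.
rewrite /= !addnA (sides_root v p A) (sides_root v _ B) (sides_root v _ C).
exact: perm_quad_left.
Qed.

Lemma perm_sides_right (n : nat) (K : fieldType) (v : nat -> K * K) (p : nat)
    (m k : option 'I_n) (A B C : tree n) :
  perm_eq (sides v p (Node m A (Node k B C)))
    [:: (k, minor v (p + leaves A) (p + leaves A + leaves B + leaves C)),
        (root_label A, minor v p (p + leaves A)),
        (root_label B, minor v (p + leaves A) (p + leaves A + leaves B)),
        (root_label C, minor v (p + leaves A + leaves B) (p + leaves A + leaves B + leaves C)),
        (m, minor v p (p + leaves A + leaves B + leaves C))
      & behead (sides v p A) ++ behead (sides v (p + leaves A) B)
        ++ behead (sides v (p + leaves A + leaves B) C)].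
Proof.
rewrite /= !addnA (sides_root v p A) (sides_root v _ B) (sides_root v _ C).
exact: perm_quad_right.
Qed.

(** A flip is a tree rotation; the quadrilateral is bounded by [m] and the roots of [A], [B],
    [C]. *)
Lemma flipped_left (n : nat) (K : fieldType) (v : nat -> K * K) (p : nat) (k : 'I_n)
    (m : option 'I_n) (A B C : tree n) :
  uniq (inner (Node m (Node (Some k) A B) C)) ->
  flipped v p k (Node m (Node (Some k) A B) C) (Node m A (Node (Some k) B C)).
Proof.
move=> U; do 7 eexists.
exists (fun i j => tree_form A i j + tree_form B i j + tree_form C i j); split.
- by split; [exact: perm_sides_left|exact: perm_sides_right].
- by rewrite /= [LHS]plucker; ring.
- by move=> i j; rewrite /= /triangle_form; ring.
- by move=> i j; rewrite /= /triangle_form; ring.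
have [ul _ _ Ck lr] := inner_node U.
have [_ _ kA kB _] := inner_node ul.
apply: isolatedD; first by apply: isolatedD; exact: isolated_tree.
by apply: isolated_tree; apply: lr; exact: mem_head.
Qed.

Lemma flipped_right (n : nat) (K : fieldType) (v : nat -> K * K) (p : nat) (k : 'I_n)
    (m : option 'I_n) (A B C : tree n) :
  uniq (inner (Node m A (Node (Some k) B C))) ->
  flipped v p k (Node m A (Node (Some k) B C)) (Node m (Node (Some k) A B) C).
Proof.
move=> U.
(* The same quadrilateral is read starting from [m], since now [m] and the root of [A] form a
   triangle with [k]. *)
exists (m, minor v p (p + leaves A + leaves B + leaves C)).
exists (root_label A, minor v p (p + leaves A)).
exists (root_label B, minor v (p + leaves A) (p + leaves A + leaves B)).
exists (root_label C, minor v (p + leaves A + leaves B) (p + leaves A + leaves B + leaves C)).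
do 3 eexists; exists (fun i j => tree_form A i j + tree_form B i j + tree_form C i j); split.
- split; first exact: perm_trans (perm_sides_right _ _ _ _ _ _ _) (perm_quad_rot _ _ _ _ _ _).
  exact: perm_trans (perm_sides_left _ _ _ _ _ _ _) (perm_quad_rot _ _ _ _ _ _).
- by rewrite /= [LHS]mulrC [LHS]plucker; ring.
- by move=> i j; rewrite /= /triangle_form; ring.
- by move=> i j; rewrite /= /triangle_form; ring.
have [_ ur _ _ lr] := inner_node U.
have [_ _ kB kC _] := inner_node ur.
apply: isolatedD; last exact: isolated_tree.
apply: isolatedD; last exact: isolated_tree.
by apply: isolated_tree; apply/negP => /lr/negP; apply; exact: mem_head.
Qed.

Lemma inner_root (n : nat) (T : tree n) (k : option 'I_n) :
  uniq (inner T) -> k \in behead (inner T) -> root_label T != k.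
Proof. by case: T => //= m l r /andP[H _] kT; apply: contraNneq H => ->. Qed.

(** As [k] is not the root of [l], the root triangle and all of [r] avoid it and join the isolated
    part. *)
Lemma flipped_node_left (n : nat) (K : fieldType) (v : nat -> K * K) (p : nat) (k : 'I_n)
    (m : option 'I_n) (l l' r : tree n) :
  uniq (inner (Node m l r)) -> Some k \in behead (inner l) -> same_shape l l' ->
  flipped v p k l l' -> flipped v p k (Node m l r) (Node m l' r).
Proof.
move=> U kl [_ rl ll]; have [ul _ ml _ lr] := inner_node U; have kl' := mem_behead kl.
case=> [a [b [c [d [y [y' [rest [M [[P P'] Y E E' HM]]]]]]]]].
exists a, b, c, d, y, y', ((m, minor v p (p + (leaves l + leaves r)))
  :: rest ++ sides v (p + leaves l) r).
exists (fun i j => triangle_form m (root_label l) (root_label r) i j + (tree_form r i j + M i j)).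
split=> //.
- by split; rewrite /= ?ll; exact: perm_quad_cons.
- by move=> i j; rewrite /= E; ring.
- by move=> i j; rewrite /= E' rl; ring.
apply: isolatedD; last apply: isolatedD => //.
  by apply: isolated_triangle; rewrite ?(inner_root ul kl) ?root_neq ?lr //;
    apply: contraNneq ml => ->.
by apply: isolated_tree; apply: lr.
Qed.



Lemma perm_quad_cons_right (T : eqType) (y a b c d m : T) (s s' s0 : seq T) :
  perm_eq s0 [:: y, a, b, c, d & s] ->
  perm_eq (m :: s' ++ s0) [:: y, a, b, c, d, m & s ++ s'].
Proof.
move=> P; apply: perm_trans (perm_quad_cons m s' P).
by rewrite perm_cons perm_catC.
Qed.

Lemma flipped_node_right (n : nat) (K : fieldType) (v : nat -> K * K) (p : nat) (k : 'I_n)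
    (m : option 'I_n) (l r r' : tree n) :
  uniq (inner (Node m l r)) -> Some k \in behead (inner r) -> same_shape r r' ->
  flipped v (p + leaves l) k r r' -> flipped v p k (Node m l r) (Node m l r').
Proof.
move=> U kr [_ rr lr']; have [_ ur _ mr lr] := inner_node U; have kr' := mem_behead kr.
have kl : Some k \notin inner l by apply/negP => /lr; rewrite kr'.
case=> [a [b [c [d [y [y' [rest [M [[P P'] Y E E' HM]]]]]]]]].
exists a, b, c, d, y, y', ((m, minor v p (p + (leaves l + leaves r)))
  :: rest ++ sides v p l).
exists (fun i j => triangle_form m (root_label l) (root_label r) i j
                   + (tree_form l i j + M i j)).
split=> //.
- by split; rewrite /= ?lr'; exact: perm_quad_cons_right.
- by move=> i j; rewrite /= E; ring.
- by move=> i j; rewrite /= E' rr; ring.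
apply: isolatedD; last apply: isolatedD => //.
  by apply: isolated_triangle; rewrite ?(inner_root ur kr) ?root_neq //;
    apply: contraNneq mr => ->.
exact: isolated_tree.
Qed.

Lemma perm_catCA_cons (T : eqType) (k : T) (a b c : seq T) :
  perm_eq (a ++ k :: b ++ c) ((k :: a ++ b) ++ c).
Proof. by rewrite cat_cons -catA; exact: (permEl (perm_catCA a [:: k] (b ++ c))). Qed.

(** Either [k] lies deeper in a subtree, or it is the root of a child and the tree is rotated
    there. *)
Lemma ex_flip (n : nat) (K : fieldType) (v : nat -> K * K) (p : nat) (k : 'I_n)
    (T : tree n) :
  uniq (inner T) -> Some k \in behead (inner T) ->
  exists2 T', same_shape T T' & flipped v p k T T'.
Proof.
elim: T p => [//|m l IHl r IHr] p U; rewrite [behead _]/= mem_cat => klr.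
have [ul ur _ _ lr] := inner_node U.
case/orP: klr => [kl|kr].
  have [kl'|kl'] := boolP (Some k \in behead (inner l)).
    have [l' S F] := IHl p ul kl'; exists (Node m l' r); last exact: flipped_node_left.
    by case: S => P _ L; split; rewrite /= ?L // perm_cons perm_cat2r.
  case: l {IHl ul lr} kl kl' U => [//|k' A B]; rewrite [behead _]/= in_cons => kl /negPf kl'.
  rewrite kl' orbF in kl; rewrite -(eqP kl) => U.
  exists (Node m A (Node (Some k) B r)); last exact: flipped_left.
  by split; rewrite /= ?addnA // perm_cons perm_catCA_cons.
have [kr'|kr'] := boolP (Some k \in behead (inner r)).
  have [r' S F] := IHr (p + leaves l)%N ur kr'; exists (Node m l r');
    last exact: flipped_node_right U kr' S F.
  by case: S => P _ L; split; rewrite /= ?L // perm_cons perm_cat2l.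
case: r {IHr ur lr} kr kr' U => [//|k' B C]; rewrite [behead _]/= in_cons => kr /negPf kr'.
rewrite kr' orbF in kr; rewrite -(eqP kr) => U.
exists (Node m (Node (Some k) l B) C); last exact: flipped_right.
by split; rewrite /= ?addnA // perm_cons perm_sym perm_catCA_cons.
Qed.

Lemma pmap_sides (n : nat) (K : fieldType) (v : nat -> K * K) (p : nat) (T : tree n) :
  pmap id (unzip1 (sides v p T)) = pmap id (inner T).
Proof.
rewrite /unzip1; elim: T p => [//|m l IHl r IHr] p /=.
by rewrite map_cat !pmap_cat IHl IHr.
Qed.

Lemma count_distinct (T : eqType) (s : seq (option T)) (i : T) :
  distinct s -> (count_mem (Some i) s <= 1)%N.
Proof.
rewrite (_ : count_mem (Some i) s = count_mem i (pmap id s)).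
  by move=> D; rewrite count_uniq_mem //; case: (_ \in _).
by elim: s => [|[j|] s IH] //=; rewrite IH.
Qed.

(** At most one of the four terms is nonzero, so positive and negative contributions do not
    cancel. *)
Lemma pos_part_alternating (p q r s : bool) :
  (p + (q + (r + (s + 0))) <= 1)%N ->
  pos_part (q%:Z - p%:Z + s%:Z - r%:Z) = q%:Z + s%:Z /\
  pos_part (- (q%:Z - p%:Z + s%:Z - r%:Z)) = p%:Z + r%:Z.
Proof. by case: p; case: q; case: r; case: s. Qed.

Section MutateQuad.

Context (n : nat) (k : 'I_n) (a b c d : option 'I_n) (M : 'I_n -> 'I_n -> int).
Context (B : 'M[int]_n).
Hypothesis D : distinct [:: Some k; a; b; c; d].
Hypothesis HM : isolated k M.
Hypothesis HB : forall i j, B i j = triangle_form (Some k) a b i j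
                                    + triangle_form (Some k) c d i j + M i j.

Let neq_k : [/\ a != Some k, b != Some k, c != Some k & d != Some k].
Proof.
move: D; rewrite distinct_cons !inE /= !negb_or => /andP[/and4P[? ? ? ?] _].
by split; rewrite eq_sym.
Qed.

Lemma quad_column (i : 'I_n) :
  B i k = (b == Some i)%:Z - (a == Some i)%:Z + (d == Some i)%:Z - (c == Some i)%:Z.
Proof.
have [/negPf ak /negPf bk /negPf ck /negPf dk] := neq_k.
rewrite HB (HM i).2 /triangle_form /label_form !eqxx ak bk ck dk.
have [ik|ik] := eqVneq (Some k) (Some i); first by case: ik => <-; rewrite ak bk ck dk.
by rewrite /=; ring.
Qed.

Lemma quad_row (j : 'I_n) : B k j = - B j k.
Proof.
rewrite !HB (HM j).1 (HM j).2 /triangle_form /label_form; ring.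
Qed.

Lemma quad_pos (i : 'I_n) :
  pos_part (B i k) = (b == Some i)%:Z + (d == Some i)%:Z /\
  pos_part (- B i k) = (a == Some i)%:Z + (c == Some i)%:Z.
Proof.
rewrite quad_column; apply: pos_part_alternating.
by have := count_distinct i (@distinct_catr _ [:: Some k] _ D).
Qed.

(** Off the row and column of [k], mutation adds the wedge of b + d with a + c. This cancels the
    wedges ab and cd of the old triangles and leaves da and bc. *)
Lemma mutate_mx_quad (i j : 'I_n) :
  mutate_mx k B i j = triangle_form (Some k) d a i j
                      + triangle_form (Some k) b c i j + M i j.
Proof.
rewrite mxE; have [/negPf ak /negPf bk /negPf ck /negPf dk] := neq_k.
case: eqVneq => [->|ik] /=.
  rewrite quad_row quad_column (HM j).1 /triangle_form /label_form eqxx ak bk ck dk.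
  have [kj|kj] := eqVneq (Some k) (Some j); first by case: kj => <-; rewrite ak bk ck dk.
  by rewrite /=; ring.
case: eqVneq => [->|jk].
  rewrite quad_column (HM i).2 /triangle_form /label_form eqxx ak bk ck dk.
  rewrite !(inj_eq Some_inj) [k == i]eq_sym (negPf ik) /=; ring.
rewrite quad_row (quad_pos i).1 opprK (quad_pos j).1 !quad_column HB.
rewrite /triangle_form /label_form !(inj_eq Some_inj) ![k == _]eq_sym (negPf ik) (negPf jk) /=.
ring.
Qed.

Lemma mutate_cluster_quad (s : preseed n) :
  exchange_mx s = B -> (forall i, cluster s i != 0) ->
  mutate_cluster k s k = (cluster s k)^-1 *
    (label_val (cluster s) b * label_val (cluster s) d
     + label_val (cluster s) a * label_val (cluster s) c).
Proof.
move=> sB x0; rewrite ffunE eqxx sB; congr (_ * (_ + _)).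
  rewrite -!monom_val_label -monom_valD //; apply: eq_bigr => i _.
  by rewrite ffunE !label_expE (quad_pos i).1.
rewrite -!monom_val_label -monom_valD //; apply: eq_bigr => i _.
by rewrite ffunE !label_expE (quad_pos i).2.
Qed.

End MutateQuad.

(** The vectors [v] and the size [N] are parameters because mutation changes the tree only: all
    seeds share one polygon. *)
Definition triangulated (n : nat) (v : nat -> ambient n * ambient n) (N : nat)
    (s : preseed n) : Prop :=
  exists T : tree n,
    [/\ root_label T = None, uniq (inner T), forall i, Some i \in inner T,
        leaves T = N & realizes (cluster s) v 0 T
        /\ forall i j, exchange_mx s i j = tree_form T i j].

(** The exchange relation at [k] is the Pluecker relation of the quadrilateral around [k], so the
    mutated variable is the minor of the flipped diagonal. *)
Lemma triangulated_mutate (n : nat) (v : nat -> ambient n * ambient n) (N : nat)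
    (k : 'I_n) (s : preseed n) :
  (forall i, cluster s i != 0) -> triangulated v N s -> triangulated v N (mutate k s).
Proof.
move=> x0 [T [rT uT iT lT [xT bT]]].
have kT : Some k \in behead (inner T).
  by have := iT k; case: (T) rT => //= m l r ->.
have [T' [P r' l'] [a [b [c [d [y [y' [rest [M [[S S'] Y E E' HM]]]]]]]]]] :=
  ex_flip v 0 uT kT.
have D : distinct (Some k :: a.1 :: b.1 :: c.1 :: d.1 :: unzip1 rest).
  rewrite -[_ :: _]/(unzip1 [:: (Some k, y), a, b, c, d & rest]).
  rewrite -(perm_distinct (perm_map fst S)) /distinct pmap_sides.
  by apply: pmap_uniq uT => //; move=> z; case: z.
have Dq : distinct [:: Some k; a.1; b.1; c.1; d.1] by apply: (@distinct_catl _ _ (unzip1 rest)).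
have xS z : z \in [:: (Some k, y), a, b, c, d & rest] -> label_val (cluster s) z.1 = z.2.
  by rewrite -(perm_mem S) => zT; apply/eqP; exact: (allP xT).
have xk : cluster s k = y by apply: (xS (Some k, y)); exact: mem_head.
have xa : label_val (cluster s) a.1 = a.2 by apply: xS; rewrite !inE eqxx ?orbT.
have xb : label_val (cluster s) b.1 = b.2 by apply: xS; rewrite !inE eqxx ?orbT.
have xc : label_val (cluster s) c.1 = c.2 by apply: xS; rewrite !inE eqxx ?orbT.
have xd : label_val (cluster s) d.1 = d.2 by apply: xS; rewrite !inE eqxx ?orbT.
exists T'; split.
- by rewrite r'.
- by rewrite (perm_uniq P).
- by move=> i; rewrite (perm_mem P).
- by rewrite l'.
split; last first.
  by move=> i j; rewrite E'; apply: (mutate_mx_quad Dq HM) => i' j'; rewrite bT E.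
apply/allP => z; rewrite (perm_mem S') in_cons => /orP[/eqP->|zr].
  have HB i j : exchange_mx s i j = triangle_form (Some k) a.1 b.1 i j
      + triangle_form (Some k) c.1 d.1 i j + M i j by rewrite bT E.
  apply/eqP; apply: (etrans (mutate_cluster_quad Dq HM HB erefl x0)).
  rewrite xa xb xc xd; apply: (mulfI (x0 k)); rewrite mulVKf // xk.
  by rewrite [RHS]Y addrC.
rewrite -(xS z); last by rewrite in_cons zr orbT.
have : z.1 != Some k.
  move: D; rewrite distinct_cons /= => /andP[H _]; apply: contraNneq H => <-.
  exact: (map_f fst zr).
case: z.1 => [j|] //= jk; rewrite ffunE.
by have [jk'|//] := eqVneq j k; rewrite jk' eqxx in jk.
Qed.

Lemma cluster_neq0 (n : nat) (s : preseed n) (i : 'I_n) : is_seed s -> cluster s i != 0.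
Proof.
case=> [[inj _] _]; apply/eqP => xi0.
have : 'X_i = 0 :> {mpoly rat[n]}.
  by apply: inj; rewrite /peval /mmap msuppX big_seq1 mmap1U xi0 mulr0.
by move/(congr1 (mcoeff U_(i))); rewrite mcoeffX eqxx mcoeff0 => /eqP; rewrite oner_eq0.
Qed.



(** * The triangulation of the seed with a Dynkin diagram of type A *)

Lemma eq_sides (n : nat) (K : fieldType) (v v' : nat -> K * K) (p p' : nat) (T : tree n) :
  (forall j, (j <= leaves T)%N -> v (p + j)%N = v' (p' + j)%N) ->
  sides v p T = sides v' p' T.
Proof.
elim: T p p' => [|m l IHl r IHr] p p' H; have H0 : v p = v' p'.
- by have := H 0%N (leq0n _); rewrite !addn0.
- by rewrite /= /minor H0 H.
- by have := H 0%N (leq0n _); rewrite !addn0.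
rewrite /= /minor H0 H //; congr (_ :: (_ ++ _)).
  by apply: IHl => j jl; apply: H; rewrite /= (leq_trans jl) ?leq_addr.
by apply: IHr => j jr; rewrite -!addnA H //= leq_add2l.
Qed.

(** Cramer's rule for the two linear conditions on [w]. *)
Lemma ex_vector (K : fieldType) (u u' : K * K) (y y' : K) :
  u.1 * u'.2 - u.2 * u'.1 != 0 ->
  exists w : K * K, u.1 * w.2 - u.2 * w.1 = y /\ u'.1 * w.2 - u'.2 * w.1 = y'.
Proof.
move=> z0; set z := u.1 * u'.2 - u.2 * u'.1 in z0.
exists ((y * u'.1 - y' * u.1) / z, (y * u'.2 - y' * u.2) / z) => /=.
by split; apply: (mulIf z0); rewrite mulrBl !mulrA !divfK // /z; ring.
Qed.

Lemma minor_root_neq0 (n : nat) (K : fieldType) (x : 'I_n -> K)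
    (v : nat -> K * K) (T : tree n) :
  (forall i, x i != 0) -> realizes x v 0 T -> minor v 0 (leaves T) != 0.
Proof.
move=> x0 /realizes_root; rewrite add0n => <-.
by case: (root_label T) => [i|] /=; rewrite ?oner_eq0.
Qed.

(** The new last vertex is determined by its minors with the two ends of the root of [T]: the value
    of [m], and 1 for the new polygon side. *)
Lemma realizes_extend_right (n : nat) (K : fieldType) (x : 'I_n -> K)
    (v : nat -> K * K) (m : option 'I_n) (T : tree n) :
  (forall i, x i != 0) -> realizes x v 0 T ->
  exists v', realizes x v' 0 (Node m T Leaf).
Proof.
move=> x0 xT; have [w [w0 wN]] := ex_vector (label_val x m) 1 (minor_root_neq0 x0 xT).
pose v' j := if (j <= leaves T)%N then v j else w.
exists v'; rewrite realizes_node !add0n addn1; apply/and3P; split.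
- by rewrite /minor /v' leq0n ltnn w0.
- rewrite /realizes (@eq_sides _ _ v' v 0 0) // => j jT.
  by rewrite /v' add0n jT.
by rewrite /realizes /= /minor /v' addn1 leqnn ltnn wN eqxx.
Qed.

Lemma realizes_extend_left (n : nat) (K : fieldType) (x : 'I_n -> K)
    (v : nat -> K * K) (m : option 'I_n) (T : tree n) :
  (forall i, x i != 0) -> realizes x v 0 T ->
  exists v', realizes x v' 0 (Node m Leaf T).
Proof.
(* The new vertex now comes first, which reverses the order in both minors and hence their signs. *)
move=> x0 xT; have [w [w0 wN]] := ex_vector (-1) (- label_val x m) (minor_root_neq0 x0 xT).
pose v' j := if j is j'.+1 then v j' else w.
exists v'; rewrite realizes_node !add0n; apply/and3P; split.
- by rewrite /minor /v' /= -[label_val x m]opprK -wN; apply/eqP; ring.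
- by rewrite /realizes /= /minor /v' /= -[1]opprK -w0 andbT; apply/eqP; ring.
by rewrite /realizes (@eq_sides _ _ v' v _ 0).
Qed.

(* The chain of diagonals is built from the inside out, each one extending the   *)
(* previous polygon by one vertex on the side given by the sign of the entry of B. *)
Section Chain.

Context (n : nat) (K : fieldType) (x : 'I_n -> K) (B : 'M[int]_n) (s : {perm 'I_n}).
Hypothesis x0 : forall i, x i != 0.
Hypothesis Bskew : forall i j, B i j = - B j i.
Hypothesis Bchain : forall i j, `|B (s i) (s j)| = ((i.+1 == j :> nat) || (j.+1 == i :> nat))%:Z.

Lemma label_form_perm (a b : option 'I_n) (i j : 'I_n) :
  label_form (omap s a) (omap s b) (s i) (s j) = label_form a b i j.
Proof.
rewrite /label_form; have E (c : option 'I_n) k : (omap s c == Some (s k)) = (c == Some k).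
  by case: c => //= c; rewrite !(inj_eq Some_inj) (inj_eq perm_inj).
by rewrite !E.
Qed.

Lemma ex_chain_tree (i : 'I_n) :
  exists (v : nat -> K * K) (T : tree n),
    [/\ root_label T = Some (s i) /\ None \notin inner T, uniq (inner T), realizes x v 0 T,
        forall j, (Some (s j) \in inner T) = (j <= i)%N
      & forall j k, tree_form T (s j) (s k) =
          if (j <= i)%N && (k <= i)%N then B (s j) (s k) else 0].
Proof.
case: i => i; elim: i => [|i IH] lt_in.
  (* The construction starts from a single polygon side, spanned by the standard basis so that its
     minor is 1. *)
  have [|v vT] := @realizes_extend_right _ _ x (fun j => if j is 0%N then (1, 0) else (0, 1))
     (Some (s (Ordinal lt_in))) Leaf x0.
    by rewrite /realizes /= /minor /= !mulr1 mul0r subr0 eqxx.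
  exists v, (Node (Some (s (Ordinal lt_in))) Leaf Leaf); split=> //= [j|j k].
    by rewrite inE (inj_eq Some_inj) (inj_eq perm_inj) leqn0.
  rewrite !addr0 /triangle_form /label_form /= !mulr0 !mul0r !leqn0.
  case: ifP => // /andP[/eqP j0 /eqP k0].
  by apply/esym/eqP; rewrite -normr_eq0 Bchain j0 k0.
have lt_i := ltnW lt_in; have [v [T [[rT NT] uT xT iT fT]]] := IH lt_i.
pose i0 := Ordinal lt_i; pose i1 := Ordinal lt_in.
have i1T : Some (s i1) \notin inner T by rewrite iT ltnn.
have [v' [T' [rT' xT' iT' fT']]] : exists v' (T' : tree n),
    [/\ root_label T' = Some (s i1), realizes x v' 0 T',
        perm_eq (inner T') (Some (s i1) :: inner T)
      & forall j k, tree_form T' (s j) (s k) =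
          B (s i1) (s i0) * label_form (Some i1) (Some i0) j k + tree_form T (s j) (s k)].
  have : (B (s i1) (s i0) == 1) || (B (s i1) (s i0) == -1).
    by have := Bchain i1 i0; rewrite /= eqxx orbT => /eqP; rewrite eqr_norml andbT.
  have E j k l l' : label_form (Some (s l)) (Some (s l')) (s j) (s k)
      = label_form (Some l) (Some l') j k := label_form_perm (Some l) (Some l') j k.
  (* As a left child [T] contributes the wedge of the new root with the old one, as a right child
     its opposite; the sign of the entry of [B] decides. *)
  case/orP => /eqP ->.
    have [v' xT'] := realizes_extend_right (Some (s i1)) x0 xT.
    exists v', (Node (Some (s i1)) T Leaf); split=> //=; first by rewrite cats0.
    move=> j k; rewrite rT addr0 mul1r; congr (_ + _).
    by rewrite /triangle_form E /label_form /= !mulr0 !mul0r subrr !addr0.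
  have [v' xT'] := realizes_extend_left (Some (s i1)) x0 xT.
  exists v', (Node (Some (s i1)) Leaf T); split=> //=.
  move=> j k; rewrite rT addr0 mulN1r; congr (_ + _).
  by rewrite /triangle_form E /label_form /= !mulr0 !mul0r subrr !add0r; ring.
exists v', T'; split=> // [|||j k].
- by rewrite (perm_mem iT') inE.
- by rewrite (perm_uniq iT') /= i1T.
- by move=> j; rewrite (perm_mem iT') inE iT (inj_eq Some_inj) (inj_eq perm_inj) [RHS]leq_eqVlt.
rewrite fT' fT.
(* The diagram is a path: among the earlier diagonals the new one is joined to the preceding one
   only. *)
have Bi1 (l : 'I_n) : (l <= i)%N -> B (s i1) (s l) = B (s i1) (s i0) * (i0 == l)%:Z.
  move=> li; have [->|il] := eqVneq i0 l; first by rewrite mulr1.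
  rewrite mulr0; apply/eqP; rewrite -normr_eq0 Bchain /= eqSS.
  have : (l : nat) != i by apply: contraNneq il => li'; apply/eqP/val_inj.
  by move=> /negPf->; rewrite orbF gtn_eqF // ltnS ltnW.
have B0 (l : 'I_n) : B (s l) (s l) = 0.
  by apply/eqP; rewrite -normr_eq0 Bchain orbb (gtn_eqF (ltnSn _)).
have lo (l : 'I_n) : (l <= i)%N -> (i1 == l) = false.
  by move=> li; apply/eqP => il; move: li; rewrite -il /= ltnn.
have hi (l : 'I_n) : (i.+1 < l)%N -> (i1 == l) = false /\ (i0 == l) = false.
  move=> il; split; apply/eqP => E; move: il; rewrite -E /= ?ltnn //.
  by rewrite ltnNge leqnSn.
have mid (l : 'I_n) : l = i.+1 :> nat -> l = i1 by move=> li; apply/val_inj.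
have i01 : (i0 == i1) = false by apply/eqP => /(congr1 val) /= /eqP; rewrite ltn_eqF.
rewrite /label_form !(inj_eq Some_inj) /=.
case: (ltngtP j i.+1) => [|ij|/mid->]; first rewrite ltnS.
- move=> ji; rewrite ji (lo _ ji); case: (ltngtP k i.+1) => [|ik|/mid->]; first rewrite ltnS.
  + by move=> ki; rewrite ki (lo _ ki) mul0r subrr mulr0 add0r.
  + by rewrite (hi _ ik).1 leqNgt (ltnW ik) /= !mul0r subrr mulr0 addr0.
  + by rewrite /= ltnn eqxx [B (s j) _]Bskew (Bi1 _ ji) mul0r mul1r sub0r addr0 mulrN.
- have -> : (j <= i)%N = false by rewrite leqNgt (ltnW ij).
  by rewrite (hi _ ij).1 (hi _ ij).2 /= mul0r mulr0 subrr mulr0 addr0.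
rewrite /= ltnn eqxx i01; case: (ltngtP k i.+1) => [|ik|/mid->]; first rewrite ltnS.
+ by move=> ki; rewrite ki (Bi1 _ ki) (lo _ ki) mul0r mul1r subr0 addr0.
+ by rewrite leqNgt (ltnW ik) (hi _ ik).1 (hi _ ik).2 /= mul1r mul0r subrr mulr0 addr0.
+ by rewrite B0 !eqxx i01 /= !mul1r subrr mulr0 addr0.
Qed.

(** One more vertex closes the polygon; the last triangle has two polygon sides and adds nothing to
    the matrix. *)
Lemma ex_triangulation :
  (0 < n)%N ->
  exists (v : nat -> K * K) (T : tree n),
    [/\ root_label T = None, uniq (inner T), realizes x v 0 T,
        forall j, Some j \in inner T
      & forall i j, B i j = tree_form T i j].
Proof.
move=> n0; have lt_n : (n.-1 < n)%N by rewrite ltn_predL.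
have [v [T [[rT NT] uT xT iT fT]]] := ex_chain_tree (Ordinal lt_n).
have max (j : 'I_n) : (j <= n.-1)%N by rewrite -ltnS prednK.
have [v' xT'] := realizes_extend_right None x0 xT.
exists v', (Node None T Leaf); split=> //=.
- by rewrite cats0 NT.
- by move=> j; rewrite in_cons cats0 -[j](permKV s) iT max.
move=> i j; rewrite rT addr0 -[i](permKV s) -[j](permKV s) fT !max /=.
by rewrite /triangle_form /label_form /= !(mulr0, mul0r, subr0, addr0, add0r).
Qed.

End Chain.

Lemma skew_symmetrizable_chain (n : nat) (B : 'M[int]_n) (s : {perm 'I_n}) :
  skew_symmetrizable B ->
  row_perm s (col_perm s (cartan_counterpart B)) = cartan_A n ->
  (forall i j, B i j = - B j i) /\
  forall i j, `|B (s i) (s j)| = ((i.+1 == j :> nat) || (j.+1 == i :> nat))%:Z.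
Proof.
move=> [d [d0 dB]] C.
have dE i j : d 0 j * B j i = - (d 0 i * B i j).
  by move/matrixP/(_ i j): dB; rewrite mul_diag_mx !mxE.
have Bii i : B i i = 0.
  have /eqP := dE i i; rewrite -addr_eq0 -mulr2n mulrn_eq0 /= mulf_eq0.
  by rewrite (gt_eqF (d0 i)) => /eqP.
have Bs i j : `|B (s i) (s j)| = ((i.+1 == j :> nat) || (j.+1 == i :> nat))%:Z.
  have [->|ij] := eqVneq i j; first by rewrite Bii normr0 orbb gtn_eqF.
  move/matrixP/(_ i j): C; rewrite !mxE (inj_eq perm_inj) (negPf ij).
  by case: ifP => _ /eqP; rewrite ?oppr_eq0 ?eqr_opp => /eqP.
split=> // i j; rewrite -[i](permKV s) -[j](permKV s).
move: (s^-1 i)%g (s^-1 j)%g => {}i {}j.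
have /eqP := etrans (Bs i j) (esym (etrans (Bs j i) (congr1 (fun b : bool => b%:Z) (orbC _ _)))).
(* If the two opposite entries were equal, the symmetrizer would give (d_i + d_j) b = 0 with d_i +
   d_j > 0, hence b = 0. *)
rewrite eqr_norm2 => /orP[|] /eqP E //; move: (dE (s i) (s j)); rewrite E => /eqP.
rewrite -addr_eq0 -mulrDl mulf_eq0 (gt_eqF (addr_gt0 (d0 _) (d0 _))) /= => /eqP->.
by rewrite oppr0.
Qed.

(** * Cluster variables of the whole pattern as minors *)

Lemma sides_minor (n : nat) (K : fieldType) (v : nat -> K * K) (p : nat) (T : tree n)
    (c : option 'I_n * K) :
  c \in sides v p T ->
  exists a b, [/\ (p <= a)%N, (a < b)%N, (b <= p + leaves T)%N & c.2 = minor v a b].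
Proof.
elim: T p => [|m l IHl r IHr] p /=.
  by rewrite inE => /eqP->; exists p, (p + 1)%N; rewrite addn1; split.
rewrite in_cons mem_cat => /or3P[/eqP->|/IHl[a [b [pa ab bq ->]]]|/IHr[a [b [pa ab bq ->]]]].
- exists p, (p + (leaves l + leaves r))%N; split=> //.
  by rewrite -[X in (X < _)%N]addn0 ltn_add2l addn_gt0 leaves_gt0.
- by exists a, b; split=> //; rewrite (leq_trans bq) // leq_add2l leq_addr.
- by exists a, b; split; rewrite ?addnA // (leq_trans _ pa) ?leq_addr.
Qed.

Lemma triangulated_cluster (n : nat) (v : nat -> ambient n * ambient n) (N : nat)
    (s : preseed n) (i : 'I_n) :
  triangulated v N s ->
  exists a b, [/\ (a < b)%N, (b <= N)%N & cluster s i = minor v a b].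
Proof.
case=> T [_ _ iT <- [xT _]].
have : i \in pmap id (unzip1 (sides v 0 T)) by rewrite pmap_sides mem_pmap_id.
rewrite mem_pmap_id => /mapP[c cT ci].
have [a [b [_ ab bq cE]]] := sides_minor cT.
exists a, b; split=> //; rewrite -cE.
by have /eqP <- := allP xT _ cT; rewrite -ci.
Qed.

Lemma triangulated_log_concave (n : nat) (v : nat -> ambient n * ambient n) (N : nat)
    (s : preseed n) (a b : nat) :
  (forall i, cluster s i != 0) -> triangulated v N s -> (a < b <= N)%N ->
  minor v a b != 0 -> log_concave_in (cluster s) (minor v a b).
Proof.
move=> x0 [T [rT uT iT <- [xT _]]] /andP[ab bN] m0.
have NT : None \notin behead (inner T).
  by case: (T) rT uT => //= m l r -> /andP[].
have [e eE lc] := log_concave_minor x0 xT NT uT (leq0n a) ab bN.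
rewrite -eE; apply: log_concave_of_exps lc; apply: contraNneq m0 => e0.
by rewrite -eE e0 /exps_val big_nil.
Qed.

Lemma ex_triangulated (n : nat) (s : preseed n) (p : {perm 'I_n}) :
  (0 < n)%N -> is_seed s ->
  row_perm p (col_perm p (cartan_counterpart (exchange_mx s))) = cartan_A n ->
  exists v N, triangulated v N s.
Proof.
move=> n0 ss C; have [Bskew Bchain] := skew_symmetrizable_chain ss.2 C.
have [v [T [rT uT xT iT bT]]] :=
  ex_triangulation (fun i => cluster_neq0 i ss) Bskew Bchain n0.
by exists v, (leaves T), T; split.
Qed.

(** Every vertex is joined to the empty word by deleting letters, and edges can be followed both
    ways. *)
Lemma triangulated_pattern (n : nat) (S : regular_tree n -> preseed n)
    (v : nat -> ambient n * ambient n) (N : nat) (t t' : regular_tree n) :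
  cluster_pattern S -> triangulated v N (S t) -> triangulated v N (S t').
Proof.
move=> [seedS mutS].
have edge k u u' : tree_edge k u u' -> triangulated v N (S u) -> triangulated v N (S u').
  by move=> /mutS-> H; apply: triangulated_mutate H => i; apply: cluster_neq0.
pose t1 : regular_tree n := exist _ [::] isT.
have from_t1 u : triangulated v N (S t1) <-> triangulated v N (S u).
  case: u => w; elim: w => [|k w IH] kw; first by rewrite (_ : exist _ _ _ = t1) //; apply/val_inj.
  have w_sorted : sorted (fun i j => i != j) w by case: (w) kw => //= j w' /andP[].
  rewrite (IH w_sorted); split; apply: (edge k); rewrite /tree_edge /= eqxx ?orbT //.
by move=> /from_t1 H; apply/from_t1.
Qed.

Theorem theorem1p2 (n : nat) (hn : (0 < n)%N)
    (S : regular_tree n -> preseed n) (hS : cluster_pattern S)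
    (hA : type_A S) (t0 : regular_tree n) :
  log_concave_cluster_algebra S t0.
Proof.
move=> i t; have [t1 [p /ex_triangulated]] := hA.
(* The same [v] and [N] serve at [t] and at [t0]: the variable is a minor by the first and is
   expanded by the second. *)
case/(_ hn (hS.1 t1)) => v [N /triangulated_pattern tri].
have [a [b [ab bN E]]] := triangulated_cluster i (tri t hS).
rewrite E; apply: triangulated_log_concave (tri t0 hS) _ _ => [j||].
- exact: cluster_neq0 (hS.1 t0).
- by rewrite ab.
- by rewrite -E; exact: cluster_neq0 (hS.1 t).
Qed.
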